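(* Let $p$ be a prime with $p\equiv 1\pmod 3$, let $\theta\in\mathcal{E}_p$ and $q\in\mathbb{Q}_p$ with $0<|\theta-1|_p<|q|_p<1$, and let $f=f_{\theta,q,3}$ be the Potts--Bethe mapping. Then: (i) $\mathbf{Fix}\{f\}=\{\mathbf{x}^{(0)},\mathbf{x}^{(1)},\mathbf{x}^{(2)},\mathbf{x}^{(3)}\}$, where $\mathbf{x}^{(0)}$ is attracting and $\mathbf{x}^{(1)},\mathbf{x}^{(2)},\mathbf{x}^{(3)}$ are repelling. (ii) $\mathrm{Dom}\{f\}\setminus(\mathcal{C}_1\cup\mathcal{C}_2\cup\mathcal{C}_3)\subset \mathfrak{B}(\mathbf{x}^{(0)})=\bigcup_{n=0}^{+\infty}f^{-n}(\mathcal{A}_0)$. (iii) There exists $\mathcal{J}\subset\mathcal{C}_1\cup\mathcal{C}_2\cup\mathcal{C}_3$ such that the dynamical system $f:\mathcal{J}\to\mathcal{J}$ is topologically conjugate to the full shift $(\Sigma_3,\sigma)$ on three symbols. (iv) With this $\mathcal{J}$, $\ \mathbb{Q}_p=\mathfrak{B}(\mathbf{x}^{(0)})\cup\mathcal{J}\cup\bigcup_{n=0}^{+\infty}f^{-n}\{\mathbf{x}^{(\infty)}\}$.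
   Context: $|\cdot|_p$ is the $p$-adic absolute value on $\mathbb{Q}_p$ and $\mathcal{E}_p=\{x\in\mathbb{Q}_p:|x-1|_p<p^{-1/(p-1)}\}$. The Potts--Bethe mapping is $$f_{\theta,q,3}(x)=\left(\frac{\theta x+q-1}{x+\theta+q-2}\right)^3,$$ with domain $\mathrm{Dom}\{f\}=\mathbb{Q}_p\setminus\{\mathbf{x}^{(\infty)}\}$, $\mathbf{x}^{(\infty)}=2-\theta-q$. $\mathbf{Fix}\{f\}$ is the set of fixed points. For $S\subset\mathbb{Q}_p$ and $n\ge 0$, $f^{-n}(S)$ is the set of $x\in\mathbb{Q}_p$ for which the $n$-th iterate $f^n(x)$ is defined and lies in $S$ ($f^0$ is the identity). A fixed point $\mathbf{x}$ is attracting if $|f'(\mathbf{x})|_p<1$ and repelling if $|f'(\mathbf{x})|_p>1$. The cubic equation $y^3-(1+\theta+\theta^2)y^2-(2\theta+1)(1-\theta-q)y-(1-\theta-q)^2=0$ has three roots $\mathbf{y}^{(1)},\mathbf{y}^{(2)},\mathbf{y}^{(3)}\in\mathbb{Z}_p$, labelled so that $|\mathbf{y}^{(1)}|_p=1>|\mathbf{y}^{(2)}|_p=|\mathbf{y}^{(3)}|_p=|1-\theta-q|_p$. Set $\mathbf{x}^{(0)}=1$ and $\mathbf{x}^{(i)}=1-q+(\theta-1)(\mathbf{y}^{(i)}-1)$ for $i=1,2,3$. Define $\mathcal{A}_0=\{x\in\mathbb{Q}_p:|x-\mathbf{x}^{(0)}|_p<|q|_p\}$, $\mathcal{C}_1=\{x\in\mathbb{Q}_p:|x-\mathbf{x}^{(1)}|_p<|x-\mathbf{x}^{(\infty)}|_p=|\theta-1|_p\}$,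 $\mathcal{C}_i=\{x\in\mathbb{Q}_p:|x-\mathbf{x}^{(i)}|_p<|x-\mathbf{x}^{(\infty)}|_p=|q|_p|\theta-1|_p\}$ for $i=2,3$. $\mathfrak{B}(\mathbf{x}^{(0)})=\{x\in\mathbb{Q}_p:\lim_{n\to\infty}f^n(x)=\mathbf{x}^{(0)}\}$ (all iterates being defined). $(\Sigma_3,\sigma)$ is the space of one-sided infinite sequences over an alphabet of three symbols with the product topology, and $\sigma$ is the left shift. *)

(* Defs.v *)
From HB Require Import structures.
From mathcomp Require Import all_boot all_order all_algebra.
From mathcomp Require Import all_classical all_reals all_analysis.
From mathcomp Require Import zify ring.

Set Implicit Arguments.
Unset Strict Implicit.
Unset Printing Implicit Defensive.

Import Order.TTheory GRing.Theory Num.Theory.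
Local Open Scope classical_set_scope.
Local Open Scope ring_scope.

(* |x|_p = p ^ (- v_p(x)), with values in rat. *)
Definition padic_absq (p : nat) (x : rat) : rat :=
  if x == 0 then 0
  else (p%:R : rat) ^ ((logn p `|denq x|)%:Z - (logn p `|numq x|)%:Z).

Section PadicAbs.
Variables (p : nat) (p_pr : prime p).
Local Notation absq := (padic_absq p).
Implicit Types x y : rat.

Lemma padic_p_gt0 : 0 < (p%:R : rat).
Proof. by rewrite ltr0n prime_gt0. Qed.

Lemma padic_p_gt1 : 1 < (p%:R : rat).
Proof. by rewrite ltr1n prime_gt1. Qed.
#[local] Hint Resolve padic_p_gt0 padic_p_gt1 : core.

Lemma padic_absq0 : absq 0 = 0.
Proof. by rewrite /padic_absq eqxx. Qed.

Lemma padic_absq_gt0 x : (0 < absq x) = (x != 0).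
Proof.
case: (eqVneq x 0) => [->|x0]; first by rewrite padic_absq0 ltxx.
by rewrite /padic_absq (negPf x0) exprz_gt0.
Qed.

Lemma padic_absq_ge0 x : 0 <= absq x.
Proof.
case: (x =P 0) => [->|/eqP]; first by rewrite padic_absq0.
by rewrite -padic_absq_gt0 => /ltW.
Qed.

Lemma padic_absq_eq0 x : (absq x == 0) = (x == 0).
Proof.
case: (x =P 0) => [->|/eqP]; first by rewrite padic_absq0 eqxx.
by rewrite -padic_absq_gt0 => /gt_eqF.
Qed.

Lemma padic_absqE (a b : int) : a != 0 -> b != 0 ->
  absq (a%:~R / b%:~R) = (p%:R : rat) ^ ((logn p `|b|)%:Z - (logn p `|a|)%:Z).
Proof.
move=> a0 b0; set x : rat := _ / _.
have x0 : x != 0 by rewrite mulf_neq0 ?invr_eq0 ?intr_eq0.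
rewrite /padic_absq (negPf x0).
have nx0 : numq x != 0 by rewrite numq_eq0.
have e : a * denq x = numq x * b.
  apply: (@intr_inj rat); rewrite !rmorphM /=.
  have -> : (numq x)%:~R = x * (denq x)%:~R by rewrite -numqE.
  by rewrite mulrAC /x mulfVK // intr_eq0.
have := congr1 (fun z : int => logn p `|z|) e.
rewrite !abszM !lognM ?absz_gt0 ?denq_neq0 // => e'.
by congr (_ ^ _); lia.
Qed.

Lemma padic_absqM x y : absq (x * y) = absq x * absq y.
Proof.
case: (x =P 0) => [->|/eqP x0]; first by rewrite mul0r padic_absq0 mul0r.
case: (y =P 0) => [->|/eqP y0]; first by rewrite mulr0 padic_absq0 mulr0.
rewrite -(divq_num_den x) -(divq_num_den y) mulf_div -!intrM.
rewrite !padic_absqE ?mulf_neq0 ?denq_neq0 ?numq_eq0 //.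
rewrite -expfzDr ?gt_eqF // !abszM !lognM ?absz_gt0 ?denq_neq0 ?numq_eq0 //.
by congr (_ ^ _); lia.
Qed.

Lemma padic_absq1 : absq 1 = 1.
Proof. by rewrite /padic_absq oner_eq0 logn1 subrr expr0z. Qed.

Lemma padic_absqN x : absq (- x) = absq x.
Proof.
have h : absq (-1) = 1.
  have /eqP := padic_absqM (-1) (-1); rewrite mulrNN mulr1 padic_absq1.
  by rewrite eq_sym -expr2 sqrp_eq1 ?padic_absq_ge0 // => /eqP.
by rewrite -mulN1r padic_absqM h mul1r.
Qed.

Lemma padic_absqV x : absq x^-1 = (absq x)^-1.
Proof.
case: (x =P 0) => [->|/eqP x0]; first by rewrite !(@invr0 rat, padic_absq0).
have ax0 : absq x != 0 by rewrite padic_absq_eq0.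
by apply: (mulfI ax0); rewrite -padic_absqM !mulfV // padic_absq1.
Qed.

Lemma padic_absqD x y : absq (x + y) <= Num.max (absq x) (absq y).
Proof.
case: (x =P 0) => [->|/eqP x0].
  by rewrite add0r le_max lexx orbT.
case: (y =P 0) => [->|/eqP y0].
  by rewrite addr0 le_max lexx.
case: (x + y =P 0) => [->|/eqP xy0].
  by rewrite padic_absq0 le_max padic_absq_ge0.
set a := numq x * denq y; set b := numq y * denq x; set d := denq x * denq y.
have d0 : d != 0 by rewrite mulf_neq0 ?denq_neq0.
have a0 : a != 0 by rewrite mulf_neq0 ?denq_neq0 ?numq_eq0.
have b0 : b != 0 by rewrite mulf_neq0 ?denq_neq0 ?numq_eq0.
have dx : (denq x)%:~R != 0 :> rat by rewrite intr_eq0 denq_neq0.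
have dy : (denq y)%:~R != 0 :> rat by rewrite intr_eq0 denq_neq0.
have xE : x = a%:~R / d%:~R.
  by rewrite !rmorphM /= -mulf_div divff // mulr1 divq_num_den.
have yE : y = b%:~R / d%:~R.
  by rewrite !rmorphM /= [_ * (denq x)%:~R]mulrC -mulf_div divff // mul1r divq_num_den.
have sE : x + y = (a + b)%:~R / d%:~R.
  by rewrite [in LHS]xE [in LHS]yE -mulrDl rmorphD.
have ab0 : a + b != 0.
  by apply: contraNneq xy0 => e; rewrite sE e mul0r.
rewrite sE {1}xE {1}yE !padic_absqE // le_max !ler_eXz2l //.
set k := minn (logn p `|a|) (logn p `|b|).
have ka : ((p ^ k)%N%:Z %| a)%Z.
  by rewrite -[a]/(a) dvdzE /= pfactor_dvdn ?absz_gt0 // geq_minl.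
have kb : ((p ^ k)%N%:Z %| b)%Z.
  by rewrite dvdzE /= pfactor_dvdn ?absz_gt0 // geq_minr.
have : ((p ^ k)%N%:Z %| a + b)%Z by rewrite rpredD.
rewrite dvdzE /= pfactor_dvdn ?absz_gt0 // /k; lia.
Qed.

Lemma padic_absqB x y : absq (x - y) <= Num.max (absq x) (absq y).
Proof. by rewrite -(padic_absqN y) padic_absqD. Qed.

Lemma padic_absq_dist x y : absq (x - y) < absq y -> absq x = absq y.
Proof.
move=> h; apply/eqP; rewrite eq_le; apply/andP; split.
  rewrite -[x](subrK y) (le_trans (padic_absqD _ _)) // ge_max lexx andbT.
  exact: ltW.
rewrite leNgt; apply/negP => h'.
have : absq y <= Num.max (absq (x - y)) (absq x).
  by rewrite -[y in X in X <= _](subKr x) maxC -(padic_absqN (x - y)) padic_absqD.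
by rewrite leNgt gt_max h h'.
Qed.

End PadicAbs.

Section PadicCauchy.
Variables (p : nat) (p_pr : prime p).
Local Notation absq := (padic_absq p).

Definition padic_cauchy : {pred nat -> rat} :=
  fun u => `[< forall e : rat, 0 < e -> exists N, forall m n,
    (N <= m)%N -> (N <= n)%N -> absq (u m - u n) < e >].

Lemma padic_cauchyP u : reflect (forall e : rat, 0 < e -> exists N, forall m n,
    (N <= m)%N -> (N <= n)%N -> absq (u m - u n) < e) (u \in padic_cauchy).
Proof. exact: asboolP. Qed.

Lemma padic_cauchy_bounded u : u \in padic_cauchy ->
  exists2 M : rat, 0 < M & forall n, absq (u n) <= M.
Proof.
move=> /padic_cauchyP/(_ 1 ltr01) [N hN].
exists (1 + \sum_(i < N.+1) absq (u i)).
  by rewrite ltr_pwDl // sumr_ge0 // => i _; exact: padic_absq_ge0.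
move=> n.
have le_sum k : (k <= N)%N -> absq (u k) <= 1 + \sum_(i < N.+1) absq (u i).
  rewrite -ltnS => kN; rewrite (bigD1 (Ordinal kN)) //= addrCA lerDl.
  by rewrite addr_ge0 // sumr_ge0 // => i _; exact: padic_absq_ge0.
case: (leqP n N) => [/le_sum //|/ltnW nN].
rewrite -[u n](subrK (u N)) (le_trans (padic_absqD p_pr _ _)) //.
rewrite ge_max le_sum // andbT (le_trans (ltW (hN n N nN (leqnn _)))) //.
by rewrite lerDl sumr_ge0 // => i _; exact: padic_absq_ge0.
Qed.

Lemma padic_cauchy_subring : subring_closed padic_cauchy.
Proof.
split => [|u v uC vC|u v uC vC].
- apply/padic_cauchyP => e e0; exists 0 => m n _ _.
  by rewrite subrr padic_absq0.
- apply/padic_cauchyP => e e0.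
  have [N hN] := padic_cauchyP _ uC e e0.
  have [M hM] := padic_cauchyP _ vC e e0.
  exists (maxn N M) => m n; rewrite !geq_max => /andP[mN mM] /andP[nN nM].
  have -> : (u - v) m - (u - v) n = (u m - u n) - (v m - v n).
    by rewrite -[(u - v) m]/(u m - v m) -[(u - v) n]/(u n - v n); ring.
  by rewrite (le_lt_trans (padic_absqB p_pr _ _)) // gt_max hN // hM.
- have [A A0 hA] := padic_cauchy_bounded uC.
  have [B B0 hB] := padic_cauchy_bounded vC.
  apply/padic_cauchyP => e e0.
  have [N hN] := padic_cauchyP _ uC (e / B) (divr_gt0 e0 B0).
  have [M hM] := padic_cauchyP _ vC (e / A) (divr_gt0 e0 A0).
  exists (maxn N M) => m n; rewrite !geq_max => /andP[mN mM] /andP[nN nM].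
  have -> : (u * v) m - (u * v) n = (u m - u n) * v m + (v m - v n) * u n.
    by rewrite -[(u * v) m]/(u m * v m) -[(u * v) n]/(u n * v n); ring.
  rewrite (le_lt_trans (padic_absqD p_pr _ _)) // gt_max !padic_absqM //.
  apply/andP; split.
    apply: le_lt_trans (ler_wpM2l (padic_absq_ge0 p_pr _) (hB _)) _.
    by rewrite -ltr_pdivlMr // hN.
  apply: le_lt_trans (ler_wpM2l (padic_absq_ge0 p_pr _) (hA _)) _.
  by rewrite -ltr_pdivlMr // hM.
Qed.

Lemma padic_cauchy_cst (c : rat) : (fun _ => c) \in padic_cauchy.
Proof.
by apply/padic_cauchyP => e e0; exists 0 => m n _ _; rewrite subrr padic_absq0.
Qed.

(* A p-adic Cauchy sequence that does not tend to 0 has an eventually constant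
   absolute value. *)
Lemma padic_cauchy_stable u : u \in padic_cauchy ->
  (exists2 c : rat, 0 < c & exists N, forall n, (N <= n)%N -> absq (u n) = c) \/
  (forall e : rat, 0 < e -> exists N, forall n, (N <= n)%N -> absq (u n) < e).
Proof.
move=> uC; have [|h] := pselect
  (forall e : rat, 0 < e -> exists N, forall n, (N <= n)%N -> absq (u n) < e).
  by right.
left; move: h => /existsNP[e /not_implyP[e0 h]].
have [N hN] := padic_cauchyP _ uC e e0.
have [n nN en] : exists2 n, (N <= n)%N & e <= absq (u n).
  apply: contrapT => h'; apply: h; exists N => n nN.
  by rewrite ltNge; apply/negP => en; apply: h'; exists n.
exists (absq (u n)); first exact: lt_le_trans en.
exists N => m mN; apply: (padic_absq_dist p_pr).
by apply: lt_le_trans en; exact: hN.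
Qed.

Definition padic_null : {pred nat -> rat} :=
  fun u => `[< forall e : rat, 0 < e ->
    exists N, forall n, (N <= n)%N -> absq (u n) < e >].

Lemma padic_nullP u : reflect (forall e : rat, 0 < e ->
    exists N, forall n, (N <= n)%N -> absq (u n) < e) (u \in padic_null).
Proof. exact: asboolP. Qed.

End PadicCauchy.

Definition padic_seq (p : nat) (p_pr : prime p) :=
  {u : nat -> rat | u \in padic_cauchy p}.

Section PadicSeq.
Variables (p : nat) (p_pr : prime p).
Local Notation absq := (padic_absq p).

HB.instance Definition _ := SubChoice.on (padic_seq p_pr).
HB.instance Definition _ :=
  GRing.isSubringClosed.Build (nat -> rat) (padic_cauchy p)
    (padic_cauchy_subring p_pr).
HB.instance Definition _ :=
  [SubChoice_isSubComNzRing of padic_seq p_pr by <:].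

Definition padic_null_seq : {pred padic_seq p_pr} :=
  fun u => val u \in padic_null p.

Lemma padic_null_idealr : idealr_closed padic_null_seq.
Proof.
split.
- apply/padic_nullP => e e0; exists 0 => n _.
  by rewrite padic_absq0.
- apply/negP => /padic_nullP /(_ 1 ltr01)[N /(_ N (leqnn _))].
  by rewrite padic_absq1 ltxx.
- move=> a u v /padic_nullP uN /padic_nullP vN.
  have [A A0 hA] := padic_cauchy_bounded p_pr (valP a).
  apply/padic_nullP => e e0.
  have [N hN] := uN (e / A) (divr_gt0 e0 A0).
  have [M hM] := vN e e0.
  exists (maxn N M) => n; rewrite geq_max => /andP[nN nM].
  apply: le_lt_trans (padic_absqD p_pr _ _) _; rewrite gt_max hM // andbT.
  rewrite padic_absqM // mulrC.
  apply: le_lt_trans (ler_wpM2l (padic_absq_ge0 p_pr _) (hA _)) _.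
  by rewrite -ltr_pdivlMr // hN.
Qed.

HB.instance Definition _ :=
  isIdealr.Build (padic_seq p_pr) padic_null_seq padic_null_idealr.

End PadicSeq.

(* Rational p-adic Cauchy sequences modulo null sequences. *)
Definition Qp_raw (p : nat) (p_pr : prime p) := {ideal_quot (@padic_null_seq p p_pr)}.

Section PadicField.
Variables (p : nat) (p_pr : prime p).
Local Notation absq := (padic_absq p).
Local Notation Qp_raw := (Qp_raw p_pr).

HB.instance Definition _ := GRing.ComNzRing.on Qp_raw.

(* The p-adic limit of a Cauchy sequence of rationals. *)
Definition Qp_lim (u : padic_seq p_pr) : Qp_raw :=
  (\pi_({ideal_quot (@padic_null_seq p p_pr)}) u)%qT.

Lemma Qp_limP x : exists u, x = Qp_lim u.
Proof. by exists (repr x); rewrite /Qp_lim reprK. Qed.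

Lemma Qp_lim_eq u v : (Qp_lim u == Qp_lim v) = (val (u - v) \in padic_null p).
Proof. by rewrite /Qp_lim -[RHS]/(u - v \in @padic_null_seq p p_pr) -Quotient.idealrBE. Qed.

Lemma Qp_limB u v : Qp_lim (u - v) = Qp_lim u - Qp_lim v.
Proof. exact: (rmorphB (\pi_({ideal_quot (@padic_null_seq p p_pr)}))%qT). Qed.

Lemma Qp_limM u v : Qp_lim (u * v) = Qp_lim u * Qp_lim v.
Proof. exact: (rmorphM (\pi_({ideal_quot (@padic_null_seq p p_pr)}))%qT). Qed.

Lemma Qp_lim1 : Qp_lim 1 = 1.
Proof. exact: (rmorph1 (\pi_({ideal_quot (@padic_null_seq p p_pr)}))%qT). Qed.

Lemma Qp_lim0 : Qp_lim 0 = 0.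
Proof. exact: (rmorph0 (\pi_({ideal_quot (@padic_null_seq p p_pr)}))%qT). Qed.

Lemma Qp_lim_eq0 u : (Qp_lim u == 0) = (val u \in padic_null p).
Proof. by rewrite -Qp_lim0 Qp_lim_eq subr0. Qed.

Lemma padic_inv_cauchy (u : nat -> rat) c N : u \in padic_cauchy p -> 0 < c ->
  (forall n, (N <= n)%N -> absq (u n) = c) ->
  (fun n => (u n)^-1) \in padic_cauchy p.
Proof.
move=> uC c0 hc; apply/padic_cauchyP => e e0.
have ec0 : 0 < e * (c * c) by rewrite !mulr_gt0.
have [M hM] := padic_cauchyP _ _ uC _ ec0.
exists (maxn N M) => m n; rewrite !geq_max => /andP[mN mM] /andP[nN nM].
have um0 : u m != 0 by rewrite -(padic_absq_gt0 p_pr) hc.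
have un0 : u n != 0 by rewrite -(padic_absq_gt0 p_pr) hc.
have -> : (u m)^-1 - (u n)^-1 = (u n - u m) * ((u m)^-1 * (u n)^-1).
  by field; rewrite ?um0 ?un0.
rewrite !padic_absqM // !padic_absqV // !hc // -invfM ltr_pdivrMr ?mulr_gt0 //.
exact: hM.
Qed.

Lemma Qp_inv_subproof (x : Qp_raw) : exists y : Qp_raw, x != 0 -> y * x = 1.
Proof.
case: (eqVneq x 0) => [_|x0]; first by exists 0.
have [u xE] := Qp_limP x.
have [[c c0 [N hN]]|uN] := padic_cauchy_stable p_pr (valP u); last first.
  by move: x0; rewrite xE Qp_lim_eq0 (introT (padic_nullP _ _) uN).
have vC := padic_inv_cauchy (valP u) c0 hN.
pose v : padic_seq p_pr := exist _ (fun n => (val u n)^-1) vC.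
exists (Qp_lim v) => _; rewrite xE -Qp_limM -Qp_lim1; apply/eqP.
rewrite Qp_lim_eq; apply/padic_nullP => e e0; exists N => n nN.
have -> : val (v * u - 1) n = (val u n)^-1 * val u n - 1 by [].
rewrite mulVf ?subrr ?padic_absq0 //.
by rewrite -(padic_absq_gt0 p_pr) hN.
Qed.

Definition Qp_inv (x : Qp_raw) : Qp_raw :=
  if x == 0 then 0 else projT1 (cid (Qp_inv_subproof x)).

Lemma Qp_mulVf x : x != 0 -> Qp_inv x * x = 1.
Proof.
by rewrite /Qp_inv; case: cid => y h x0; rewrite ifN ?h.
Qed.

Lemma Qp_invr0 : Qp_inv 0 = 0.
Proof. by rewrite /Qp_inv ifT. Qed.

HB.instance Definition _ :=
  GRing.ComNzRing_isField.Build Qp_raw Qp_mulVf Qp_invr0.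

(* The p-adic absolute value takes its values in {0} U p^Z, hence in rat.  If x
   is the limit of u then |u n| is eventually equal to |x| unless u tends to 0;
   in that case the set below is empty or {0}. *)
Definition Qp_raw_abs (x : Qp_raw) : rat :=
  xget 0 [set r | exists N, forall n, (N <= n)%N -> absq (val (repr x) n) = r].

Lemma Qp_raw_abs_lim u r N : 0 < r ->
  (forall n, (N <= n)%N -> absq (val u n) = r) -> Qp_raw_abs (Qp_lim u) = r.
Proof.
move=> r0 ur; rewrite /Qp_raw_abs; set w := repr _.
have : Qp_lim w == Qp_lim u by rewrite /Qp_lim reprK.
rewrite Qp_lim_eq => /padic_nullP /(_ r r0) [M hM].
have wr n : (maxn N M <= n)%N -> absq (val w n) = r.
  rewrite geq_max => /andP[nN nM]; rewrite -(ur n nN).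
  by apply: (padic_absq_dist p_pr); rewrite (ur n nN); exact: hM.
apply: xget_unique; first by exists (maxn N M).
move=> s [K hK]; set k := maxn K (maxn N M).
by rewrite -(hK k) ?wr // leq_max leqnn ?orbT.
Qed.

Lemma Qp_raw_abs0 : Qp_raw_abs 0 = 0.
Proof.
rewrite /Qp_raw_abs; set w := repr _.
have : Qp_lim w == 0 by rewrite /Qp_lim reprK.
rewrite Qp_lim_eq0 => /padic_nullP wN.
case: xgetP => // r _ [N hN]; apply/eqP/negPn/negP => r0.
have r_gt0 : 0 < r.
  by rewrite lt_neqAle eq_sym r0 -(hN N (leqnn _)) padic_absq_ge0.
have [M hM] := wN r r_gt0.
have := hM (maxn N M) (leq_maxr _ _).
by rewrite hN ?leq_maxl // ltxx.
Qed.

Lemma Qp_raw_abs_stable u : Qp_lim u != 0 ->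
  exists N, forall n, (N <= n)%N -> absq (val u n) = Qp_raw_abs (Qp_lim u).
Proof.
move=> u0.
have [[c c0 [N hN]]|uN] := padic_cauchy_stable p_pr (valP u); last first.
  by move: u0; rewrite Qp_lim_eq0 (introT (padic_nullP _ _) uN).
by exists N => n nN; rewrite hN // (Qp_raw_abs_lim c0 hN).
Qed.

Lemma Qp_raw_abs_gt0 x : (0 < Qp_raw_abs x) = (x != 0).
Proof.
case: (eqVneq x 0) => [->|]; first by rewrite Qp_raw_abs0 ltxx.
have [u ->] := Qp_limP x => u0.
have [[c c0 [N hN]]|uN] := padic_cauchy_stable p_pr (valP u); last first.
  by move: u0; rewrite Qp_lim_eq0 (introT (padic_nullP _ _) uN).
by rewrite (Qp_raw_abs_lim c0 hN).
Qed.

Lemma Qp_raw_abs_ge0 x : 0 <= Qp_raw_abs x.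
Proof.
case: (eqVneq x 0) => [->|]; first by rewrite Qp_raw_abs0.
by rewrite -Qp_raw_abs_gt0 => /ltW.
Qed.

Lemma Qp_raw_abs_eq0 x : (Qp_raw_abs x == 0) = (x == 0).
Proof.
case: (eqVneq x 0) => [->|]; first by rewrite Qp_raw_abs0 eqxx.
by rewrite -Qp_raw_abs_gt0 => /gt_eqF.
Qed.

Lemma Qp_raw_absM x y : Qp_raw_abs (x * y) = Qp_raw_abs x * Qp_raw_abs y.
Proof.
case: (eqVneq x 0) => [->|x0]; first by rewrite mul0r Qp_raw_abs0 mul0r.
case: (eqVneq y 0) => [->|y0]; first by rewrite mulr0 Qp_raw_abs0 mulr0.
have [u xE] := Qp_limP x; have [v yE] := Qp_limP y.
rewrite xE in x0 *; rewrite yE in y0 *.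
have [N hN] := Qp_raw_abs_stable x0; have [M hM] := Qp_raw_abs_stable y0.
rewrite -Qp_limM; apply: (@Qp_raw_abs_lim _ _ (maxn N M)).
  by rewrite mulr_gt0 // Qp_raw_abs_gt0.
move=> n; rewrite geq_max => /andP[nN nM].
by rewrite -(hN n nN) -(hM n nM) -padic_absqM.
Qed.

Lemma Qp_raw_abs1 : Qp_raw_abs 1 = 1.
Proof.
rewrite -Qp_lim1; apply: (@Qp_raw_abs_lim _ _ 0) => // n _.
by rewrite -(padic_absq1 p).
Qed.

Lemma Qp_raw_abs_lim_lt u e : Qp_raw_abs (Qp_lim u) < e ->
  exists N, forall n, (N <= n)%N -> absq (val u n) < e.
Proof.
move=> ue; have e0 : 0 < e := le_lt_trans (Qp_raw_abs_ge0 _) ue.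
case: (eqVneq (Qp_lim u) 0) => [|u0].
  by move/eqP; rewrite Qp_lim_eq0 => /padic_nullP; exact.
have [N hN] := Qp_raw_abs_stable u0; exists N => n nN.
by rewrite hN.
Qed.

Lemma Qp_raw_absB x y :
  Qp_raw_abs (x - y) <= Num.max (Qp_raw_abs x) (Qp_raw_abs y).
Proof.
rewrite leNgt; apply/negP; rewrite gt_max => /andP[].
have [u ->] := Qp_limP x; have [v ->] := Qp_limP y; rewrite -Qp_limB.
move=> /[dup] h /Qp_raw_abs_lim_lt [N hN] /Qp_raw_abs_lim_lt [M hM].
have uv0 : Qp_lim (u - v) != 0.
  by rewrite -Qp_raw_abs_gt0 (le_lt_trans _ h) ?Qp_raw_abs_ge0.
have [K hK] := Qp_raw_abs_stable uv0; set n := maxn K (maxn N M).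
have := padic_absqB p_pr (val u n) (val v n).
rewrite -[val u n - val v n]/(val (u - v) n) hK ?leq_maxl // leNgt gt_max.
by rewrite hN ?hM // !leq_max leqnn ?orbT.
Qed.

Definition Qp_raw_of_rat (c : rat) : Qp_raw :=
  Qp_lim (exist _ (fun=> c) (padic_cauchy_cst p c)).

Let Qp_raw_of_rat_zmod_morphism : zmod_morphism Qp_raw_of_rat.
Proof.
move=> a b; rewrite -Qp_limB; congr Qp_lim; exact: val_inj.
Qed.

Let Qp_raw_of_rat_monoid_morphism : monoid_morphism Qp_raw_of_rat.
Proof.
split=> [|a b]; first by rewrite -Qp_lim1; congr Qp_lim; exact: val_inj.
by rewrite -Qp_limM; congr Qp_lim; exact: val_inj.
Qed.

HB.instance Definition _ := GRing.isZmodMorphism.Build rat Qp_raw Qp_raw_of_rat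
  Qp_raw_of_rat_zmod_morphism.
HB.instance Definition _ := GRing.isMonoidMorphism.Build rat Qp_raw Qp_raw_of_rat
  Qp_raw_of_rat_monoid_morphism.

Lemma Qp_raw_of_ratE c : Qp_raw_of_rat c = ratr c.
Proof. exact: fmorph_eq_rat. Qed.

Lemma Qp_raw_ratrB a b : ratr (a - b) = ratr a - ratr b :> Qp_raw.
Proof. by rewrite -!Qp_raw_of_ratE rmorphB. Qed.

Lemma Qp_raw_abs_rat (c : rat) : Qp_raw_abs (ratr c) = absq c.
Proof.
rewrite -Qp_raw_of_ratE; case: (eqVneq c 0) => [->|c0].
  by rewrite rmorph0 Qp_raw_abs0 padic_absq0.
apply: (@Qp_raw_abs_lim _ _ 0) => //.
by rewrite padic_absq_gt0.
Qed.

Lemma Qp_lim_cvg u (e : rat) : 0 < e -> exists N, forall n, (N <= n)%N ->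
  Qp_raw_abs (Qp_lim u - ratr (val u n)) < e.
Proof.
move=> e0; have [N hN] := padic_cauchyP _ _ (valP u) e e0.
exists N => n nN; rewrite -Qp_raw_of_ratE -Qp_limB ltNge; apply/negP => h.
set w := u - _ in h.
have w0 : Qp_lim w != 0 by rewrite -Qp_raw_abs_gt0 (lt_le_trans e0).
have [M hM] := Qp_raw_abs_stable w0.
have := hN (maxn N M) n (leq_maxl _ _) nN.
rewrite -[val u _ - _]/(val w (maxn N M)) hM ?leq_maxr // ltNge.
by rewrite h.
Qed.

Lemma Qp_raw_lim (c : nat -> rat) : c \in padic_cauchy p ->
  exists x : Qp_raw, forall e : rat, 0 < e -> exists N, forall n, (N <= n)%N ->
    Qp_raw_abs (x - ratr (c n)) < e.
Proof.
move=> cC; pose u : padic_seq p_pr := exist _ c cC.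
by exists (Qp_lim u) => e e0; exact: (Qp_lim_cvg u e0).
Qed.

Lemma Qp_raw_dense (x : Qp_raw) (e : rat) : 0 < e ->
  exists c : rat, Qp_raw_abs (x - ratr c) < e.
Proof.
move=> e0; have [u ->] := Qp_limP x; have [N hN] := Qp_lim_cvg u e0.
by exists (val u N); exact: hN.
Qed.

End PadicField.

(* Q_p with its absolute value; locked so that tactics and conversion tests do
   not unfold the construction. *)
HB.lock Definition Qp_data (p : nat) (p_pr : prime p) :
    {F : fieldType & F -> rat} :=
  existT (fun F : fieldType => F -> rat) (Qp_raw p_pr) (@Qp_raw_abs p p_pr).

Definition Qp (p : nat) (p_pr : prime p) : Type := projT1 (Qp_data p_pr).

HB.instance Definition _ (p : nat) (p_pr : prime p) :=
  GRing.Field.copy (Qp p_pr) (projT1 (Qp_data p_pr)).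

Definition padic_abs (p : nat) (p_pr : prime p) (x : Qp p_pr) : rat :=
  projT2 (Qp_data p_pr) x.

Section PadicNumbers.
Variables (p : nat) (p_pr : prime p).
Local Notation absq := (padic_absq p).
Local Notation Qp := (Qp p_pr).
Local Notation abs := (@padic_abs p p_pr).

Let Qp_data_ind (P : {F : fieldType & F -> rat} -> Prop) :
  P (existT (fun F : fieldType => F -> rat) (Qp_raw p_pr) (@Qp_raw_abs p p_pr)) ->
  P (Qp_data p_pr).
Proof. by rewrite Qp_data.unlock. Qed.

Lemma padic_abs_eq0 (x : Qp) : (abs x == 0) = (x == 0).
Proof.
exact: (@Qp_data_ind (fun D => forall x : projT1 D, (projT2 D x == 0) = (x == 0))
  (@Qp_raw_abs_eq0 p p_pr)).
Qed.

Lemma padic_abs_ge0 (x : Qp) : 0 <= abs x.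
Proof.
exact: (@Qp_data_ind (fun D => forall x : projT1 D, 0 <= projT2 D x)
  (@Qp_raw_abs_ge0 p p_pr)).
Qed.

Lemma padic_absM (x y : Qp) : abs (x * y) = abs x * abs y.
Proof.
exact: (@Qp_data_ind (fun D => forall x y : projT1 D,
  projT2 D (x * y) = projT2 D x * projT2 D y)
  (@Qp_raw_absM p p_pr)).
Qed.

Lemma padic_absB (x y : Qp) : abs (x - y) <= Num.max (abs x) (abs y).
Proof.
exact: (@Qp_data_ind (fun D => forall x y : projT1 D,
  projT2 D (x - y) <= Num.max (projT2 D x) (projT2 D y))
  (@Qp_raw_absB p p_pr)).
Qed.

Lemma padic_abs_rat (c : rat) : abs (ratr c) = absq c.
Proof.
exact: (@Qp_data_ind (fun D => forall c : rat, projT2 D (ratr c) = absq c)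
  (@Qp_raw_abs_rat p p_pr)).
Qed.

Lemma Qp_ratrB a b : ratr (a - b) = ratr a - ratr b :> Qp.
Proof.
exact: (@Qp_data_ind (fun D => forall a b : rat,
  ratr (a - b) = ratr a - ratr b :> projT1 D)
  (@Qp_raw_ratrB p p_pr)).
Qed.

Lemma Qp_rat_dense (x : Qp) (e : rat) : 0 < e ->
  exists c : rat, abs (x - ratr c) < e.
Proof.
exact: (@Qp_data_ind (fun D => forall (x : projT1 D) (e : rat), 0 < e ->
  exists c : rat, projT2 D (x - ratr c) < e)
  (@Qp_raw_dense p p_pr)).
Qed.

Lemma Qp_rat_lim (c : nat -> rat) : c \in padic_cauchy p ->
  exists x : Qp, forall e : rat, 0 < e -> exists N, forall n, (N <= n)%N ->
    abs (x - ratr (c n)) < e.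
Proof.
exact: (@Qp_data_ind (fun D => forall c : nat -> rat, c \in padic_cauchy p ->
  exists x : projT1 D, forall e : rat, 0 < e -> exists N, forall n, (N <= n)%N ->
    projT2 D (x - ratr (c n)) < e)
  (@Qp_raw_lim p p_pr)).
Qed.

Lemma padic_abs0 : abs 0 = 0.
Proof. by apply/eqP; rewrite padic_abs_eq0. Qed.

Lemma padic_abs_gt0 (x : Qp) : (0 < abs x) = (x != 0).
Proof. by rewrite lt_neqAle eq_sym padic_abs_eq0 padic_abs_ge0 andbT. Qed.

Lemma padic_abs1 : abs 1 = 1.
Proof.
have n0 : abs 1 != 0 by rewrite padic_abs_eq0 oner_eq0.
by apply: (mulfI n0); rewrite -padic_absM !mulr1.
Qed.

Lemma padic_absN (x : Qp) : padic_abs (- x) = padic_abs x.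
Proof.
have h : abs (-1) = 1.
  have /eqP := padic_absM (-1) (-1); rewrite mulrNN mulr1 padic_abs1.
  by rewrite eq_sym -expr2 sqrp_eq1 ?padic_abs_ge0 // => /eqP.
by rewrite -mulN1r padic_absM h mul1r.
Qed.

Lemma padic_absD (x y : Qp) :
  padic_abs (x + y) <= Num.max (padic_abs x) (padic_abs y).
Proof. by rewrite -(padic_absN y) -[in X in X <= _](opprK y) padic_absB. Qed.

Lemma padic_abs_distC (x y : Qp) : padic_abs (x - y) = padic_abs (y - x).
Proof. by rewrite -padic_absN opprB. Qed.

Let padic_distxx (x : Qp) : padic_abs (x - x) = 0.
Proof. by rewrite subrr padic_abs0. Qed.

Let padic_dist_eq0 (x y : Qp) : padic_abs (x - y) = 0 -> x = y.
Proof. by move/eqP; rewrite padic_abs_eq0 subr_eq0 => /eqP. Qed.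

Let padic_dist_triangle (y x z : Qp) :
  padic_abs (x - z) <= padic_abs (x - y) + padic_abs (y - z).
Proof.
rewrite -[x - z](subrKA y) (le_trans (padic_absD _ _)) // ge_max.
by rewrite lerDl lerDr !padic_abs_ge0.
Qed.

HB.instance Definition _ := isPointed.Build Qp 0.
HB.instance Definition _ := @isMetric.Build rat Qp (fun x y => padic_abs (x - y))
  padic_distxx padic_dist_eq0 padic_abs_distC padic_dist_triangle.

Lemma Qp_ballE (x : Qp) (e : rat) : ball x e = [set y | padic_abs (x - y) < e].
Proof. by []. Qed.

Let Qp_cauchy_cvg (F : set_system Qp) : ProperFilter F -> cauchy F -> cvg F.
Proof.
move=> FF /(@cauchyP rat) FC.
pose d n : rat := n.+1%:R^-1.
have d0 n : 0 < d n by rewrite invr_gt0 ltr0n.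
have d_mono m n : (m <= n)%N -> d n <= d m.
  by move=> mn; rewrite lef_pV2 ?posrE ?ltr0n // ler_nat.
have d_small (e : rat) : 0 < e -> exists n, d n < e.
  move=> e0; exists (Num.truncn e^-1); rewrite /d invf_plt ?posrE ?ltr0n //.
  exact: truncnS_gt.
have ratF n : exists c : rat, F (ball (ratr c : Qp) (d n)).
  have [y Fy] := FC _ (d0 n).
  have [c hc] := Qp_rat_dense y (d0 n); exists c.
  apply: filterS Fy => z yz; rewrite Qp_ballE /mkset.
  rewrite -[_ - z](subrKA y) (le_lt_trans (padic_absD _ _)) // gt_max yz andbT.
  by rewrite padic_abs_distC.
have [c hc] := choice ratF.
have cdist m n : absq (c m - c n) < Num.max (d m) (d n).
  have [z [mz nz]] := filter_ex (filterI (hc m) (hc n)).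
  have {}mz : padic_abs (ratr (c m) - z) < d m := mz.
  have {}nz : padic_abs (z - ratr (c n)) < d n by rewrite padic_abs_distC.
  rewrite -padic_abs_rat Qp_ratrB -(subrKA z).
  apply: le_lt_trans (padic_absD _ _) _.
  rewrite gt_max; apply/andP; split; rewrite lt_max; apply/orP.
    by left.
  by right.
have cC : c \in padic_cauchy p.
  apply/padic_cauchyP => e /d_small[N hN]; exists N => m n mN nN.
  apply: lt_le_trans (cdist m n) _; rewrite ge_max.
  by rewrite !(le_trans (d_mono _ _ _) (ltW hN)).
have [x hx] := Qp_rat_lim cC.
apply/cvg_ex; exists x; apply/(@fcvg_ballP rat) => e e0.
have [N hN] := d_small e e0; have [M hM] := hx e e0.
set n := maxn N M; have dn : d n < e := le_lt_trans (d_mono _ _ (leq_maxl N M)) hN.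
apply: filterS (hc n) => z cz; rewrite Qp_ballE /mkset.
rewrite -(subrKA (ratr (c n))) (le_lt_trans (padic_absD _ _)) // gt_max.
by rewrite (lt_trans cz dn) hM // leq_maxr.
Qed.

HB.instance Definition _ := Uniform_isComplete.Build Qp Qp_cauchy_cvg.

End PadicNumbers.

Section PartialMaps.
Variable X : Type.

Definition partial_iter (f : X -> option X) (n : nat) (x : X) : option X :=
  iter n (obind f) (Some x).

Definition partial_dom (f : X -> option X) : set X := [set x | f x <> None].

Definition partial_fix (f : X -> option X) : set X := [set x | f x = Some x].

(* f^{-n}(S) *)
Definition partial_preimage (f : X -> option X) (n : nat) (S : set X) : set X :=
  [set x | exists2 y, partial_iter f n x = Some y & S y].

End PartialMaps.

Definition basin (X : topologicalType) (f : X -> option X) (a : X) : set X :=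
  [set x | exists2 u : nat -> X,
     (forall n, partial_iter f n x = Some (u n)) & u @ \oo --> a].

(* f restricts to a map J -> J, and h : J -> Y is a homeomorphism, with inverse
   g, carrying this restriction to s. *)
Definition conjugate_on (X Y : topologicalType) (f : X -> option X)
    (J : set X) (s : Y -> Y) : Prop :=
  (forall x, J x -> exists2 y, f x = Some y & J y) /\
  exists (h : X -> Y) (g : Y -> X),
    [/\ {within J, continuous h} /\ continuous g,
        forall w, J (g w),
        forall x, J x -> g (h x) = x,
        forall w, h (g w) = w &
        forall x y, J x -> f x = Some y -> h y = s (h x)].

Definition full_shift (k : nat) : topologicalType :=
  prod_topology (fun _ : nat => discrete_topology 'I_k).

Definition left_shift (k : nat) (w : full_shift k) : full_shift k :=
  fun n => w n.+1.

Section PottsBethe.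
Variables (p : nat) (p_pr : prime p).
Local Notation Qp := (Qp p_pr).

Definition Qp_is_deriv (f : Qp -> Qp) (x d : Qp) : Prop :=
  (fun y => (f y - f x) / (y - x)) @ x^' --> d.

(* The disc |x - 1| < p ^ (- 1 / (p - 1)); the real field R is only needed to
   state the radius. *)
Definition padic_exp_disc (R : realType) : set Qp :=
  [set x | ratr (padic_abs (x - 1)) < p%:R `^ (- (p%:R - 1)^-1) :> R].

Variables (theta q : Qp).

Definition potts_pole : Qp := 2 - theta - q.

(* Meaningful away from potts_pole only; the Potts-Bethe mapping itself is the
   partial map potts_bethe. *)
Definition potts_bethe_expr (x : Qp) : Qp :=
  ((theta * x + q - 1) / (x + theta + q - 2)) ^+ 3.

Definition potts_bethe (x : Qp) : option Qp :=
  if x == potts_pole then None else Some (potts_bethe_expr x).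

Definition potts_attracting (x : Qp) : Prop :=
  partial_fix potts_bethe x /\
  exists2 d, Qp_is_deriv potts_bethe_expr x d & padic_abs d < 1.

Definition potts_repelling (x : Qp) : Prop :=
  partial_fix potts_bethe x /\
  exists2 d, Qp_is_deriv potts_bethe_expr x d & 1 < padic_abs d.

Definition potts_cubic (y : Qp) : Qp :=
  y ^+ 3 - (1 + theta + theta ^+ 2) * y ^+ 2
  - (2 * theta + 1) * (1 - theta - q) * y - (1 - theta - q) ^+ 2.

Definition potts_cubic_roots (y1 y2 y3 : Qp) : Prop :=
  [/\ uniq [:: y1; y2; y3],
      forall y, y \in [:: y1; y2; y3] -> potts_cubic y = 0 /\ padic_abs y <= 1,
      padic_abs y1 = 1,
      padic_abs y2 = padic_abs (1 - theta - q) /\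
      padic_abs y3 = padic_abs (1 - theta - q) &
      padic_abs (1 - theta - q) < 1].

Definition potts_fixpt (y : Qp) : Qp := 1 - q + (theta - 1) * (y - 1).

Definition potts_A0 : set Qp := [set x | padic_abs (x - 1) < padic_abs q].

Definition potts_C1 (y1 : Qp) : set Qp :=
  [set x | padic_abs (x - potts_fixpt y1) < padic_abs (x - potts_pole) /\
           padic_abs (x - potts_pole) = padic_abs (theta - 1)].

(* C_2 and C_3 *)
Definition potts_C23 (y : Qp) : set Qp :=
  [set x | padic_abs (x - potts_fixpt y) < padic_abs (x - potts_pole) /\
           padic_abs (x - potts_pole) = padic_abs q * padic_abs (theta - 1)].

End PottsBethe.

(* Main.v *)
(* Put t = theta - 1 and c = t + q, so that |c| = |q|.  In the coordinate
   z = x - x_infty the map f is the cube of the Moebius map u = theta - t c / z,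
   and everything follows from ultrametric estimates on u.  The disc A_0 is
   contracted towards 1 by the factor |t / q|.  Each C_i is the disc of radius
   rho_i = |x_i - x_infty| about x_i, where rho_1 = |t| and rho_2 = rho_3 = |t q|;
   on it f multiplies distances by |t q| / rho_i^2 > 1 and, by Hensel's lemma
   applied to the cube root, its image contains the disc |z| < |q|, which in turn
   contains the three C_i.  Three full expanding branches give the conjugacy with
   the shift.  A point outside the C_i, other than the pole, falls into A_0 after
   at most two steps; the critical case |z| = |t q| uses that u x_2 and u x_3
   reduce to the two primitive cube roots of unity, so that |u^3 - 1| = 1.  The
   fixed points x_i come from the cubic through Hensel's lemma, using a primitive
   cube root of unity in Q_p. *)
Require Import Defs.
From HB Require Import structures.
From mathcomp Require Import all_boot all_order all_algebra all_fingroup all_solvable.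
From mathcomp Require Import all_field.
From mathcomp Require Import all_classical all_reals all_analysis.
From mathcomp Require Import ring lra zify.

Set Implicit Arguments.
Unset Strict Implicit.
Unset Printing Implicit Defensive.

Import Order.TTheory GRing.Theory Num.Theory.
Local Open Scope classical_set_scope.
Local Open Scope ring_scope.

(** * p-adic absolute value, completeness and Hensel's lemma *)

Section PadicHensel.
Variables (p : nat) (p_pr : prime p).
Local Notation Qp := (Qp p_pr).
Local Notation abs := (@padic_abs p p_pr).
Implicit Types (x y z : Qp) (e K l : rat).

Lemma padic_absV x : abs x^-1 = (abs x)^-1.
Proof.
have [->|x0] := eqVneq x 0; first by rewrite invr0 padic_abs0 invr0.
have ax0 : abs x != 0 by rewrite padic_abs_eq0.
by apply: (mulfI ax0); rewrite -padic_absM !mulfV // padic_abs1.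
Qed.

Lemma padic_absX x n : abs (x ^+ n) = abs x ^+ n.
Proof.
elim: n => [|n IHn]; first by rewrite !expr0 padic_abs1.
by rewrite !exprS padic_absM IHn.
Qed.

Lemma padic_absD_le x y e : abs x <= e -> abs y <= e -> abs (x + y) <= e.
Proof. by move=> xe ye; rewrite (le_trans (padic_absD _ _)) // ge_max xe. Qed.

Lemma padic_absB_le x y e : abs x <= e -> abs y <= e -> abs (x - y) <= e.
Proof. by move=> xe ye; rewrite padic_absD_le // padic_absN. Qed.

Lemma padic_absD_lt x y e : abs x < e -> abs y < e -> abs (x + y) < e.
Proof. by move=> xe ye; rewrite (le_lt_trans (padic_absD _ _)) // gt_max xe. Qed.

Lemma padic_absB_lt x y e : abs x < e -> abs y < e -> abs (x - y) < e.
Proof. by move=> xe ye; rewrite padic_absD_lt // padic_absN. Qed.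

(** If [|x + y|] were below [|x|], then [x = (x + y) - y] would be smaller than itself. This is the
    source of all exact values of [abs] below. *)
Lemma padic_absDl x y : abs y < abs x -> abs (x + y) = abs x.
Proof.
move=> yx; apply/eqP; rewrite eq_le padic_absD_le ?(ltW yx) //= leNgt.
apply/negP => xyx; have := padic_absB_lt xyx yx.
by rewrite addrK ltxx.
Qed.

Lemma padic_absDr x y : abs x < abs y -> abs (x + y) = abs y.
Proof. by move=> xy; rewrite addrC padic_absDl. Qed.

Lemma padic_absBl x y : abs y < abs x -> abs (x - y) = abs x.
Proof. by move=> yx; rewrite padic_absDl // padic_absN. Qed.

Lemma padic_absBr x y : abs x < abs y -> abs (x - y) = abs y.
Proof. by move=> xy; rewrite padic_abs_distC padic_absBl. Qed.

Lemma padic_absM_le1 x y : abs x <= 1 -> abs y <= 1 -> abs (x * y) <= 1.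
Proof. by move=> x1 y1; rewrite padic_absM mulr_ile1 ?padic_abs_ge0. Qed.

Lemma padic_abs_eq_le1 x : abs x = 1 -> abs x <= 1.
Proof. by move=> ->. Qed.

Lemma padic_absM_lt1 x y : abs x < 1 -> abs y <= 1 -> abs (x * y) < 1.
Proof.
move=> x1 y1; rewrite padic_absM (le_lt_trans _ x1) //.
by rewrite ler_piMr ?padic_abs_ge0.
Qed.

Lemma padic_absX_le1 x n : abs x <= 1 -> abs (x ^+ n) <= 1.
Proof. by move=> x1; rewrite padic_absX exprn_ile1 ?padic_abs_ge0. Qed.

Lemma padic_abs_nat_le1 n : abs n%:R <= 1.
Proof.
by elim: n => [|n IHn]; rewrite ?padic_abs0 // -natr1 padic_absD_le ?padic_abs1.
Qed.

Lemma padic_abs_natE n : abs n%:R = padic_absq p n%:R.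
Proof.
rewrite -padic_abs_rat; congr abs.
by rewrite [X in ratr X]pmulrn /ratr numq_int denq_int divr1.
Qed.

Lemma padic_abs_nat_lt1 n : (p %| n)%N -> abs n%:R < 1.
Proof.
case: n => [_|n pn]; first by rewrite padic_abs0.
rewrite padic_abs_natE pmulrn /padic_absq ifN ?intr_eq0 //.
rewrite numq_int denq_int logn1 sub0r -invr_expz invf_lt1 ?exprz_gt0 ?padic_p_gt0 //.
by rewrite exprn_egt1 ?padic_p_gt1 // -lt0n logn_gt0 mem_primes p_pr.
Qed.

Lemma padic_abs_nat_eq1 n : ~~ (p %| n)%N -> abs n%:R = 1.
Proof.
move=> pn; have n0 : n != 0%N by apply: contraNneq pn => ->.
rewrite padic_abs_natE pmulrn /padic_absq ifN ?intr_eq0 //.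
rewrite numq_int denq_int logn1 sub0r absz_nat.
suff -> : logn p n = 0%N by [].
by apply/eqP; rewrite lognE p_pr (negPf pn) andbF.
Qed.

(** The Bernoulli-type bound [l ^ n * (1 + n (1 - l)) <= 1] gives an explicit exponent and stays
    inside [rat]. *)
Lemma geometric_small K l e : 0 <= l < 1 -> 0 < e ->
  exists n, K * l ^+ n < e.
Proof.
move=> /andP[l0 l1] e0.
have l10 : 0 < 1 - l by rewrite subr_gt0.
have bern n : l ^+ n * (1 + n%:R * (1 - l)) <= 1.
  elim: n => [|n IHn]; first by rewrite expr0 mul0r addr0 mulr1.
  apply: le_trans IHn; rewrite exprS -mulrA mulrCA ler_wpM2l ?exprn_ge0 //.
  rewrite -subr_ge0 -natr1.
  have -> : 1 + n%:R * (1 - l) - l * (1 + (n%:R + 1) * (1 - l)) =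
      (n%:R + 1) * (1 - l) ^+ 2 by ring.
  by rewrite mulr_ge0 ?sqr_ge0 // natr1.
have [K0|K0] := leP K 0.
  by exists 0%N; rewrite expr0 mulr1 (le_lt_trans K0).
exists (Num.truncn (K / e / (1 - l))).+1; set n := _.+1.
have hn : K / e / (1 - l) < n%:R by exact: truncnS_gt.
have {hn} : K / e < n%:R * (1 - l) by rewrite -ltr_pdivrMr.
rewrite ltr_pdivrMr // => hn.
have := bern n; have := exprn_ge0 n l0; set s := l ^+ n => s0 hs.
have {}hs : s * (1 + n%:R * (1 - l)) <= 1 := hs.
set m := n%:R * (1 - l) in hn hs.
have m0 : 0 < m by rewrite mulr_gt0 // ltr0n.
nra.
Qed.

Lemma padic_geometric_eq0 x K l : 0 <= l < 1 ->
  (forall n, abs x <= K * l ^+ n) -> x = 0.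
Proof.
move=> l01 hx; apply/eqP; rewrite -padic_abs_eq0 eq_le padic_abs_ge0 andbT.
rewrite leNgt; apply/negP => x0; have [n hn] := geometric_small K l01 x0.
by have := le_lt_trans (hx n) hn; rewrite ltxx.
Qed.

(** In an ultrametric the n-th increment bounds the distance from [u n] to every later term, so no
    sum of the series enters and the limit inherits the same bound. *)
Lemma padic_geometric_lim (u : nat -> Qp) K l : 0 <= K -> 0 <= l < 1 ->
  (forall n, abs (u n.+1 - u n) <= K * l ^+ n) ->
  exists x, forall n, abs (x - u n) <= K * l ^+ n.
Proof.
move=> K0 l01 hu.
have [l0 l1] := andP l01.
have hmono n m : (n <= m)%N -> K * l ^+ m <= K * l ^+ n.
  by move=> nm; rewrite ler_wpM2l // ler_wiXn2l // ltW.
have hd n k : abs (u (n + k)%N - u n) <= K * l ^+ n.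
  elim: k => [|k IHk]; first by rewrite addn0 subrr padic_abs0 mulr_ge0 ?exprn_ge0.
  rewrite -(subrKA (u (n + k)%N)) padic_absD_le // addnS (le_trans (hu _)) //.
  by rewrite hmono // leq_addr.
have uc : cvg (u @ \oo).
  apply: cauchy_cvg; apply/(@cauchyP rat) => e e0.
  have [n hn] := geometric_small K l01 e0.
  exists (u n); exists n => // m /= nm.
  rewrite -(subnKC nm) [X in X _]Qp_ballE /= padic_abs_distC.
  by apply: le_lt_trans hn.
exists (lim (u @ \oo)) => n; set x := lim _.
(* Otherwise a late term, closer to [x] than [|x - u n|] and within [K * l ^+ n] of [u n], would
   make [|x - u n|] smaller than itself. *)
rewrite leNgt; apply/negP => hn.
have {uc} : u @ \oo --> x by exact: uc.
have xn0 : 0 < abs (x - u n) by rewrite (le_lt_trans _ hn) // mulr_ge0 // exprn_ge0.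
move=> /(@cvg_ballP rat)/(_ _ xn0) [m _ /(_ (maxn n m) (leq_maxr _ _))].
rewrite Qp_ballE /= => hm.
have := hd n (maxn n m - n)%N; rewrite subnKC ?leq_maxl // => hnm.
have := padic_absD_lt hm (le_lt_trans hnm hn).
by rewrite subrKA ltxx.
Qed.

(* Newton iteration with the derivative frozen at the initial point: on the disc
   of radius |P(x0)| it contracts by the factor |P(x0)|. *)
Lemma padic_hensel_cubic (A B C D x0 : Qp) :
  let P x := A * x ^+ 3 + B * x ^+ 2 + C * x + D in
  abs A <= 1 -> abs B <= 1 -> abs x0 <= 1 -> abs (P x0) < 1 ->
  abs (3 * A * x0 ^+ 2 + 2 * B * x0 + C) = 1 ->
  exists2 x, P x = 0 & abs (x - x0) <= abs (P x0).
Proof.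
move=> P A1 B1 x01; set l := abs (P x0) => l1; set d := _ + C => d1.
have l0 : 0 <= l by exact: padic_abs_ge0.
have dn0 : d != 0 by rewrite -padic_abs_eq0 d1 oner_eq0.
have le1 (e : Qp) : abs e <= l -> abs e <= 1 by move=> /le_trans-> //; exact: ltW.
(* Second-order Taylor remainder at [x0]: it factors through [x - y], and each term of the cofactor
   contains [x - x0] or [y - x0], of size at most [l]. *)
have Pd x y : abs (x - x0) <= l -> abs (y - x0) <= l ->
    abs (P x - P y - d * (x - y)) <= l * abs (x - y).
  set e := x - x0; set e' := y - x0 => el e'l.
  have -> : P x - P y - d * (x - y) =
      (A * (3%:R * x0 * (e + e') + (e * e + e * e' + e' * e')) + B * (e + e'))
      * (x - y) by rewrite /P /d /e /e'; ring.
  rewrite padic_absM ler_wpM2r ?padic_abs_ge0 //.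
  have ee'l : abs (e + e') <= l by exact: padic_absD_le.
  have lM (s t : Qp) : abs s <= 1 -> abs t <= l -> abs (s * t) <= l.
    by move=> s1 tl; rewrite padic_absM -[l]mul1r ler_pM ?padic_abs_ge0.
  rewrite padic_absD_le // lM // padic_absD_le // ?lM //.
    by rewrite padic_absM_le1 // padic_abs_nat_le1.
  by rewrite !padic_absD_le // lM // le1.
pose N x := x - P x / d; pose u n := iter n N x0.
have Nd x : N x - x = - (P x / d) by rewrite /N; ring.
have aNd x : abs (N x - x) = abs (P x).
  by rewrite Nd padic_absN padic_absM padic_absV d1 invr1 mulr1.
have hu n : abs (u n - x0) <= l /\ abs (P (u n)) <= l * l ^+ n.
  elim: n => [|n [IH1 IH2]]; first by rewrite /u /= subrr padic_abs0 expr0 mulr1.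
  have ux0 : abs (u n.+1 - x0) <= l.
    rewrite -(subrKA (u n)) padic_absD_le // /u iterS aNd (le_trans IH2) //.
    by rewrite ler_piMr // exprn_ile1 // ltW.
  split=> //; have := Pd _ _ ux0 IH1.
  (* The Newton step is chosen so that [P (u n) + d * (u n.+1 - u n) = 0]; the remainder is then
     [P (u n.+1)] itself. *)
  have -> : P (u n.+1) - P (u n) - d * (u n.+1 - u n) = P (u n.+1).
    rewrite /u iterS Nd mulrN mulrC divfK //; ring.
  move=> /le_trans; apply; rewrite /u iterS aNd exprS mulrCA -exprS.
  by rewrite exprS ler_wpM2l // ler_wpM2l.
have [|n|x hx] := @padic_geometric_lim u l l l0.
- by rewrite l0.
- by rewrite /u iterS aNd; have [] := hu n.
have xx0 : abs (x - x0) <= l by have := hx 0%N; rewrite expr0 mulr1.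
exists x => //; apply: (@padic_geometric_eq0 _ l l); first by rewrite l0.
move=> n; have [un Pun] := hu n.
have -> : P x = (P x - P (u n) - d * (x - u n)) + (d * (x - u n) + P (u n)).
  by ring.
apply: padic_absD_le.
  apply: le_trans (Pd _ _ xx0 un) _; rewrite (le_trans _ (hx n)) //.
  by rewrite ler_piMl ?padic_abs_ge0 // ltW.
by apply: padic_absD_le => //; rewrite padic_absM d1 mul1r.
Qed.

(** Hensel's lemma for [X^3 - (u^3 + d)] at [u], where the derivative [3 u^2] is a unit. *)
Lemma padic_cube_root (u d : Qp) : abs 3 = 1 -> abs u = 1 -> abs d < 1 ->
  exists2 v, v ^+ 3 = u ^+ 3 + d & abs (v - u) <= abs d.
Proof.
move=> h3 u1 d1.
have [|||||v] := @padic_hensel_cubic 1 0 0 (- (u ^+ 3 + d)) u.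
- by rewrite padic_abs1.
- by rewrite padic_abs0.
- by rewrite u1.
- by rewrite (_ : _ + _ = - d) ?padic_absN //; ring.
- by rewrite mulr1 mulr0 mul0r !addr0 padic_absM padic_absX h3 u1 !mul1r.
rewrite (_ : 1 * u ^+ 3 + _ + _ + _ = - d); last by ring.
rewrite padic_absN => hv vu; exists v => //.
by apply/eqP; rewrite -subr_eq0 -hv; apply/eqP; ring.
Qed.

(** Cubing is an isometry on the residue disc of a unit: in [e (3 u^2 + e (3 u + e))] the cofactor
    of [e] is the unit [3 u^2] plus a smaller term. *)
Lemma padic_abs_cubeB (u v : Qp) : abs 3 = 1 -> abs u = 1 -> abs (v - u) < 1 ->
  abs (v ^+ 3 - u ^+ 3) = abs (v - u).
Proof.
move=> h3 u1; set e := v - u => e1.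
have -> : v ^+ 3 - u ^+ 3 = e * (3 * u ^+ 2 + e * (3 * u + e)).
  by rewrite /e; ring.
have h : abs (3 * u ^+ 2) = 1 by rewrite padic_absM padic_absX h3 u1 mul1r expr1n.
rewrite padic_absM [X in _ * X]padic_absDl h ?mulr1 //.
rewrite padic_absM (le_lt_trans _ e1) // ler_piMr ?padic_abs_ge0 //.
by rewrite padic_absD_le ?(ltW e1) // padic_absM h3 u1 mul1r.
Qed.

(** Since 3 divides [p - 1], Cauchy's theorem gives an element of order 3 in the units of ['F_p]; an
    integer representative is lifted by Hensel's lemma. *)
Lemma padic_primitive_cube_root : p = 1 %[mod 3] ->
  exists2 w : Qp, w ^+ 2 + w + 1 = 0 & abs w <= 1.
Proof.
move=> p13.
have p3 : ~~ (p %| 3)%N.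
  rewrite dvdn_prime2 //; apply/eqP => pE; by rewrite pE in p13.
have [m pm] : exists m, (p %| m ^ 2 + m + 1)%N.
  have pc := card_Fp p_pr.
  have : (3 %| #|[set: {unit 'F_p}]%SET|)%N.
    rewrite card_finField_unit pc; have := prime_gt0 p_pr; move: p13; lia.
  move=> /(@Cauchy _ 3 _ isT)[g _ og].
  have g3 : (g ^+ 3 = 1)%g by rewrite -og expg_order.
  have g1 : g != 1%g by rewrite -order_eq1 og.
  pose a : 'F_p := FinRing.uval g.
  have a3 : a ^+ 3 = 1 by rewrite /a -FinRing.val_unitX g3.
  have a1 : a - 1 != 0.
    by rewrite subr_eq0; apply: contraNneq g1 => a1; apply/eqP/val_inj.
  exists (val a).
  have : (val a ^ 2 + val a + 1)%:R == 0 :> 'F_p.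
    rewrite !natrD natrX natr_Zp -(mulrI_eq0 _ (mulfI a1)).
    by apply/eqP; rewrite -[RHS](subrr 1) -[X in _ = X - _]a3; ring.
  by rewrite -(dvdn_pcharf (pchar_Fp p_pr)).
have m1 : abs (m%:R ^+ 2 + m%:R + 1) < 1.
  by have := padic_abs_nat_lt1 pm; rewrite !natrD natrX.
(* The square of this derivative is the discriminant -3 plus a multiple of the small number
   [m^2 + m + 1], hence a unit. *)
have dm1 : abs (2 * m%:R + 1) = 1.
  have : abs ((2 * m%:R + 1) ^+ 2) = 1.
    have -> : (2 * m%:R + 1 : Qp) ^+ 2 = 4%:R * (m%:R ^+ 2 + m%:R + 1) - 3%:R.
      by ring.
    rewrite padic_absBr (padic_abs_nat_eq1 p3) // padic_absM.
    by rewrite (le_lt_trans _ m1) // ler_piMl ?padic_abs_ge0 ?padic_abs_nat_le1.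
  by rewrite padic_absX => /eqP; rewrite sqrp_eq1 ?padic_abs_ge0 // => /eqP.
have [|||||w] := @padic_hensel_cubic 0 1 1 1 m%:R.
- by rewrite padic_abs0.
- by rewrite padic_abs1.
- exact: padic_abs_nat_le1.
- by rewrite mul0r add0r !mul1r.
- by rewrite mulr0 mul0r add0r mulr1.
rewrite !mul0r !add0r !mul1r => hw wm; exists w => //.
rewrite -(subrK m%:R w) padic_absD_le ?padic_abs_nat_le1 //.
by rewrite (le_trans wm) // ltW.
Qed.

End PadicHensel.

(** Proves that a polynomial expression has absolute value at most 1 by recursion on its shape;
    hypotheses close the leaves. *)
Ltac padic_int :=
  first [assumption |
  lazymatch goal with
  | |- is_true (padic_abs (_ + _) <= _) => apply: padic_absD_le; padic_int
  | |- is_true (padic_abs (- _) <= _) => rewrite padic_absN; padic_int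
  | |- is_true (padic_abs (_ ^+ _) <= _) => apply: padic_absX_le1; padic_int
  | |- is_true (padic_abs (_ * _) <= _) => apply: padic_absM_le1; padic_int
  | |- is_true (padic_abs (_ *+ _) <= _) => exact: padic_abs_nat_le1
  | |- _ => first [done | by rewrite padic_abs1 | exact: ltW
                  | exact: padic_abs_eq_le1]
  end].

(** * Expanding full branches and the shift *)

Lemma partial_iterS (X : Type) (f : X -> option X) n x :
  partial_iter f n.+1 x = obind f (partial_iter f n x).
Proof. by []. Qed.

Lemma partial_iterD (X : Type) (f : X -> option X) m n x y :
  partial_iter f m x = Some y ->
  partial_iter f (n + m) x = partial_iter f n y.
Proof. by move=> xy; elim: n => // n IHn; rewrite addSn !partial_iterS IHn. Qed.

Lemma basin_preimage (X : ptopologicalType) (f : X -> option X) (a x y : X) n :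
  partial_iter f n x = Some y -> basin f a y -> basin f a x.
Proof.
move=> xy [u uE ua].
have xm m : partial_iter f (m + n) x = Some (u m).
  by rewrite (partial_iterD _ xy).
(* An orbit that is undefined at some time remains undefined, which contradicts the values known
   from time [n] on. *)
have xdef m : exists z, partial_iter f m x = Some z.
  case E: (partial_iter f m x) => [z|]; first by exists z.
  have : partial_iter f (n + m) x = None.
    by elim: n {xy xm} => // n IHn; rewrite addSn partial_iterS IHn.
  by rewrite addnC xm.
have [v vE] := choice xdef; exists v => //.
rewrite -(cvg_shiftn n).
suff -> : (fun m => v (m + n)%N) = u by [].
by apply/funext => m; apply: Some_inj; rewrite -vE xm.
Qed.

Lemma full_shift_nbhs_cylinder k (w : full_shift k) n :
  nbhs w [set w' | forall j, (j < n)%N -> w' j = w j].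
Proof.
elim: n => [|n IHn]; first exact: filterS filterT.
have wn : nbhs w [set w' : full_shift k | w' n = w n].
  exact: (@proj_continuous nat (fun=> discrete_topology 'I_k) n w _
    (discrete_set1 (w n : discrete_topology 'I_k))).
apply: filterS (filterI IHn wn) => w' [hw' w'n] j.
by rewrite ltnS leq_eqVlt => /predU1P[->|/hw'].
Qed.

Lemma full_shift_cvg k (F : set_system (full_shift k)) (w : full_shift k) :
  Filter F -> (forall n, F [set w' | w' n = w n]) -> F --> w.
Proof.
move=> FF Fw; apply/cvg_sup => n A [_ [[B _ <-] Bw BA]].
by apply: filterS (Fw n) => w' w'n; apply: BA; rewrite /preimage /= w'n.
Qed.

(** * Limits of sums, products and inverses in Q_p along a filter *)

Section PadicLimits.
Variables (p : nat) (p_pr : prime p) (T : Type) (F : set_system T).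
Hypothesis FF : Filter F.
Local Notation Qp := (Qp p_pr).
Local Notation abs := (@padic_abs p p_pr).
Implicit Types (f g : T -> Qp) (a b : Qp).

Lemma padic_cvgP f a : f @ F --> a <->
  forall e, 0 < e -> \forall x \near F, abs (a - f x) < e.
Proof. exact: (@cvg_ballP rat). Qed.

Lemma padic_cvgD f g a b : f @ F --> a -> g @ F --> b ->
  (fun x => f x + g x) @ F --> a + b.
Proof.
move=> /padic_cvgP fa /padic_cvgP gb; apply/padic_cvgP => e e0.
apply: filterS2 (fa _ e0) (gb _ e0) => x fx gx.
by rewrite opprD addrACA padic_absD_lt.
Qed.

Lemma padic_cvgM f g a b : f @ F --> a -> g @ F --> b ->
  (fun x => f x * g x) @ F --> a * b.
Proof.
move=> /padic_cvgP fa /padic_cvgP gb; apply/padic_cvgP => e e0.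
(* The added 1 keeps the divisors positive; in the second one it also absorbs [|b - g x| < 1] in the
   bound for [|g x|]. *)
have A0 : 0 < abs a + 1 by rewrite ltr_wpDl ?padic_abs_ge0.
have B0 : 0 < abs b + 1 by rewrite ltr_wpDl ?padic_abs_ge0.
apply: filterS3 (fa _ (divr_gt0 e0 B0)) (gb _ (divr_gt0 e0 A0)) (gb _ ltr01).
move=> x fx gx gx1.
have -> : a * b - f x * g x = a * (b - g x) + (a - f x) * g x by ring.
apply: padic_absD_lt; rewrite padic_absM.
  apply: le_lt_trans (_ : (abs a + 1) * abs (b - g x) < e).
    by rewrite ler_wpM2r ?padic_abs_ge0 // lerDl.
  by rewrite mulrC -ltr_pdivlMr.
apply: le_lt_trans (_ : abs (a - f x) * (abs b + 1) < e); last first.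
  by rewrite -ltr_pdivlMr.
rewrite ler_wpM2l ?padic_abs_ge0 // -[g x](subKr b) padic_absB_le ?lerDl //.
by rewrite (le_trans (ltW gx1)) // lerDr padic_abs_ge0.
Qed.

Lemma padic_cvgV f a : a != 0 -> f @ F --> a -> (fun x => (f x)^-1) @ F --> a^-1.
Proof.
move=> a0 /padic_cvgP fa; apply/padic_cvgP => e e0.
have A0 : 0 < abs a by rewrite padic_abs_gt0.
have A2 : 0 < e * (abs a * abs a) by rewrite !mulr_gt0.
apply: filterS2 (fa _ A0) (fa _ A2) => x fx fxe.
have afx : abs (f x) = abs a by rewrite -[f x](subKr a) padic_absBl.
have fx0 : f x != 0 by rewrite -padic_abs_gt0 afx.
have -> : a^-1 - (f x)^-1 = - (a - f x) / (a * f x) by field; rewrite a0 fx0.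
by rewrite padic_absM padic_absN padic_absV padic_absM afx ltr_pdivrMr ?mulr_gt0.
Qed.

End PadicLimits.

(** * Symbolic coding: the disc of radius [r] about [b] contains every [C i] and is covered by each
    image of [C i], with inverse branches contracting by [l] *)

Section FullBranches.
Variables (p : nat) (p_pr : prime p) (k : nat).
Local Notation Qp := (Qp p_pr).
Local Notation abs := (@padic_abs p p_pr).
Local Notation shift := (@left_shift k).
Variables (f : Qp -> option Qp) (C : 'I_k -> set Qp) (b : Qp) (r l : rat)
  (L : 'I_k -> rat).

(** A relation rather than a function, since a point whose orbit leaves the discs or becomes
    undefined has no code. *)
Definition itinerary (x : Qp) (w : full_shift k) : Prop :=
  exists2 u : nat -> Qp,
    forall n, partial_iter f n x = Some (u n) & forall n, C (w n) (u n).

Definition survivors : set Qp := [set x | exists w, itinerary x w].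

Hypothesis k0 : (0 < k)%N.
Hypothesis r0 : 0 < r.
Hypothesis l01 : 0 <= l < 1.
Hypothesis C_inj : forall i j x, C i x -> C j x -> i = j.
Hypothesis C_sub : forall i x, C i x -> abs (x - b) < r.
Hypothesis C_open : forall i x, C i x ->
  exists2 d, 0 < d & forall y, abs (y - x) < d -> C i y.
Hypothesis f_onto : forall i y, abs (y - b) < r ->
  exists2 x, C i x & f x = Some y.
Hypothesis f_expand : forall i x x' y y', C i x -> C i x' ->
  f x = Some y -> f x' = Some y' -> abs (x - x') <= l * abs (y - y').
Hypothesis f_lipschitz : forall i x x' y y', C i x -> C i x' ->
  f x = Some y -> f x' = Some y' -> abs (y - y') <= L i * abs (x - x').

Lemma itinerary_inj x w w' : itinerary x w -> itinerary x w' -> w = w'.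
Proof.
move=> [u uE uC] [u' u'E u'C]; apply/funext => n.
by apply: (C_inj (uC n)); have := uE n; rewrite u'E => -[<-].
Qed.

Lemma itinerary_shift x y w : itinerary x w -> f x = Some y ->
  itinerary y (shift w).
Proof.
move=> [u uE uC] xy; exists (fun n => u n.+1) => [n|n]; last exact: uC.
have y1 : partial_iter f 1 x = Some y by [].
by rewrite -(partial_iterD _ y1) addn1.
Qed.

Lemma itineraryS x w : itinerary x w ->
  C (w 0%N) x /\ exists2 y, f x = Some y & itinerary y (shift w).
Proof.
move=> xw; have [u uE uC] := xw.
have ux : x = u 0%N by apply: Some_inj; exact: (uE 0%N).
split; first by rewrite ux.
have fx : f x = Some (u 1%N) by exact: (uE 1%N).
by exists (u 1%N) => //; exact: itinerary_shift xw fx.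
Qed.

(** Each common symbol lets one pull the two orbits back through the same inverse branch, gaining a
    factor [l]; the start is the radius [r] of the disc. *)
Lemma itinerary_close n x x' w w' : itinerary x w -> itinerary x' w' ->
  (forall j, (j < n)%N -> w j = w' j) -> abs (x - x') <= r * l ^+ n.
Proof.
elim: n x x' w w' => [|n IHn] x x' w w' /itineraryS[Cx [y xy yw]]
    /itineraryS[Cx' [y' x'y' y'w']] ww'.
  rewrite expr0 mulr1 ltW // -[x](subrK b) -addrA padic_absD_lt //.
    exact: C_sub Cx.
  by rewrite padic_abs_distC; exact: C_sub Cx'.
rewrite -(ww' 0%N) // in Cx'.
rewrite (le_trans (f_expand Cx Cx' xy x'y')) // exprS mulrCA.
have [l0 _] := andP l01.
by rewrite ler_wpM2l // (IHn _ _ _ _ yw y'w') // => j jn; exact: ww'.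
Qed.

Lemma itinerary_unique x x' w : itinerary x w -> itinerary x' w -> x = x'.
Proof.
move=> xw x'w; apply/eqP; rewrite -subr_eq0; apply/eqP.
apply: (@padic_geometric_eq0 _ _ _ r l) => // n.
exact: itinerary_close xw x'w _.
Qed.

(* The point coded by w is the limit of g_(w 0) (g_(w 1) (... (g_(w n) b))),
   where g_i is the inverse branch of f with values in C i. *)
Lemma itinerary_exists w : exists x, itinerary x w.
Proof.
have [l0 l1] := andP l01.
(* The inverse branches are made total: outside the disc they are unspecified, with [b] as a
   placeholder. *)
have /choice[g gP] : forall iy : 'I_k * Qp, exists x, abs (iy.2 - b) < r ->
    C iy.1 x /\ f x = Some iy.2.
  move=> [i y] /=.
  have [yb|yb] := pselect (abs (y - b) < r); last by exists b.
  by have [x Cx xy] := f_onto i yb; exists x.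
pose fix z n (w : full_shift k) {struct n} :=
  if n is n'.+1 then g (w 0%N, z n' (shift w)) else b.
have zE n v : z n.+1 v = g (v 0%N, z n (shift v)) by [].
have g_sub i y : abs (y - b) < r -> abs (g (i, y) - b) < r.
  by move=> yb; apply: C_sub (proj1 (gP (i, y) yb)).
have g_contr i y y' : abs (y - b) < r -> abs (y' - b) < r ->
    abs (g (i, y) - g (i, y')) <= l * abs (y - y').
  move=> yb yb'; have [Cg gy] := gP (i, y) yb; have [Cg' gy'] := gP (i, y') yb'.
  exact: f_expand Cg Cg' gy gy'.
have zb n v : abs (z n v - b) < r.
  elim: n v => [|n IHn] v; first by rewrite subrr padic_abs0.
  by rewrite zE g_sub.
have zS n v : abs (z n.+1 v - z n v) <= r * l ^+ n.
  elim: n v => [|n IHn] v; first by rewrite expr0 mulr1 ltW // zb.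
  rewrite (zE n.+1 v) (zE n v).
  apply: le_trans (g_contr _ _ _ (zb _ _) (zb _ _)) _.
  by rewrite exprS mulrCA ler_wpM2l.
have Zex v : exists x, forall n, abs (x - z n v) <= r * l ^+ n.
  exact: (@padic_geometric_lim _ _ (z^~ v) r l (ltW r0) l01 (fun n => zS n v)).
have [Z ZP] := choice Zex.
have Zb v : abs (Z v - b) < r.
  have [n hn] := geometric_small r l01 r0.
  by rewrite -(subrKA (z n v)) padic_absD_lt // (le_lt_trans (ZP _ _)).
(* Both sides are limits of the same approximants: each is within [r * l ^+ n.+1] of [z n.+1 v].
   Applying [f] to this equation shifts the word. *)
have ZE v : Z v = g (v 0%N, Z (shift v)).
  apply/eqP; rewrite -subr_eq0; apply/eqP.
  apply: (@padic_geometric_eq0 _ _ _ (r * l) l) => // n.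
  rewrite -(subrKA (z n.+1 v)) padic_absD_le //.
    by rewrite -mulrA -exprS.
  rewrite padic_abs_distC zE.
  apply: le_trans (g_contr _ _ _ (Zb _) (zb _ _)) _.
  by rewrite -mulrA mulrCA ler_wpM2l.
exists (Z w), (fun n => Z (fun m => w (m + n)%N)) => n; last first.
  rewrite ZE /left_shift; exact: (proj1 (gP (_, _) (Zb _))).
elim: n => [|n IHn].
  by congr (Some (Z _)); apply/funext => m; rewrite addn0.
rewrite partial_iterS IHn /= ZE.
have [_ ->] := gP (w (0 + n)%N, _) (Zb (shift (fun m => w (m + n)%N))).
congr (Some (Z _)); apply/funext => m; rewrite /left_shift.
by congr w; lia.
Qed.

(** Continuity of the coding, by induction on [n]: openness of the discs fixes the first symbol, and
    the Lipschitz bound carries nearness over to the images. *)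
Lemma itinerary_nbhs n x w : itinerary x w ->
  exists2 d, 0 < d & forall x' w', itinerary x' w' -> abs (x' - x) < d ->
    w' n = w n.
Proof.
elim: n x w => [|n IHn] x w /itineraryS[Cx [y xy yw]].
  have [d d0 hd] := C_open Cx; exists d => // x' w' /itineraryS[Cx' _] x'x.
  by apply: C_inj Cx' _; exact: hd.
have [d d0 hd] := C_open Cx; have [e e0 he] := IHn _ _ yw.
(* [L] may have any sign, so the positive number [|K| + 1] serves as Lipschitz constant. *)
set K := L (w 0%N); have KP : 0 < `|K| + 1 by rewrite ltr_wpDl.
exists (Num.min d (e / (`|K| + 1))) => [|x' w' x'w'].
  by rewrite lt_min d0 divr_gt0.
rewrite lt_min => /andP[x'd x'e].
have [Cx' [y' x'y' y'w']] := itineraryS x'w'.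
rewrite -[w' _]/(shift w' n) -[w _]/(shift w n); apply: he y'w' _.
apply: le_lt_trans (f_lipschitz (hd _ x'd) Cx x'y' xy) _.
apply: le_lt_trans (_ : (`|K| + 1) * abs (x' - x) < e).
  by rewrite ler_wpM2r ?padic_abs_ge0 // (le_trans (ler_norm _)) // lerDl.
by rewrite mulrC -ltr_pdivlMr.
Qed.

Lemma survivors_conjugate : conjugate_on f survivors shift.
Proof.
have [l0 l1] := andP l01.
split=> [x [w xw]|].
  by have [_ [y xy yw]] := itineraryS xw; exists y => //; exists (shift w).
have [g gP] := choice itinerary_exists.
(* Off the survivors [h] takes a constant word as a dummy value. *)
have /choice[h hP] : forall x, exists w, survivors x -> itinerary x w.
  move=> x.
  have [[w xw]|nx] := pselect (survivors x); first by exists w.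
  by exists (fun=> Ordinal k0).
exists h, g; split=> [|w|x /hP xh|w|x y Jx xy].
- split.
    apply/subspace_continuousP => x Jx; apply: full_shift_cvg => n.
    have [d d0 hd] := itinerary_nbhs n (hP _ Jx).
    apply/(@nbhs_ballP rat); exists d => // y.
    rewrite Qp_ballE /= padic_abs_distC => yd Jy.
    exact: hd (hP _ Jy) yd.
  move=> w A /(@nbhs_ballP rat)[e /= e0 eA].
  have [n hn] := geometric_small r l01 e0.
  apply: filterS (full_shift_nbhs_cylinder w n) => w' ww'.
  apply: eA; apply: le_lt_trans hn.
  by apply: itinerary_close (gP w) (gP w') _ => j jn; rewrite ww'.
- by exists w; exact: gP.
- exact: itinerary_unique (gP _) xh.
- exact: itinerary_inj (hP _ (ex_intro _ _ (gP w))) (gP w).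
- have xh := hP _ Jx; have yh := itinerary_shift xh xy.
  exact: itinerary_inj (hP _ (ex_intro _ _ yh)) yh.
Qed.

Lemma survivors_sub : survivors `<=` \bigcup_i C i.
Proof. by move=> x [w /itineraryS[Cx _]]; exists (w 0%N). Qed.

(** An orbit that never meets an undefined image and never leaves the discs can be read off as a
    code; this dichotomy yields the final covering of Q_p. *)
Lemma survivors_or_escape x : survivors x \/
  exists n y, partial_iter f n x = Some y /\
    (f y = None \/ forall i, ~ C i y).
Proof.
have [|esc] := pselect (exists n y, partial_iter f n x = Some y /\
    (f y = None \/ forall i, ~ C i y)); first by right.
left; have stay n y : partial_iter f n x = Some y ->
    f y <> None /\ exists i, C i y.
  move=> xy; split=> [fy|]; first by apply: esc; exists n, y; split => //; left.
  apply: contrapT => nC; apply: esc; exists n, y; split=> //; right=> i Ci.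
  by apply: nC; exists i.
have xdef n : exists y, partial_iter f n x = Some y.
  elim: n => [|n [y xy]]; first by exists x.
  have [fy _] := stay _ _ xy; rewrite partial_iterS xy /=.
  by case: (f y) fy => // z _; exists z.
have [u uE] := choice xdef.
have [w wC] := choice (fun n => (stay _ _ (uE n)).2).
by exists w, u.
Qed.

End FullBranches.

(** * Roots of the Potts cubic *)

Section PottsCubic.
Variables (p : nat) (p_pr : prime p) (theta q : Qp p_pr).
Local Notation abs := (@padic_abs p p_pr).
Local Notation t := (theta - 1).
Local Notation c := (theta - 1 + q).

Hypothesis p13 : p = 1 %[mod 3].
Hypothesis t_lt1 : abs t < 1.
Hypothesis c_gt0 : 0 < abs c.
Hypothesis c_lt1 : abs c < 1.
Hypothesis abs3 : abs 3 = 1.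

Let t_le1 : abs t <= 1 := ltW t_lt1.

Let theta_le1 : abs theta <= 1.
Proof. by rewrite -(subrK 1 theta); padic_int. Qed.

Let c_le1 : abs c <= 1 := ltW c_lt1.

Let coef2_le1 : abs (1 + theta + theta ^+ 2) <= 1.
Proof. padic_int. Qed.

(** Modulo the maximal ideal [theta = 1] and [c = 0], so the cubic reduces to [y^2 (y - 3)], and 3
    is a simple root with derivative 9. *)
Lemma potts_cubic_unit_root : exists2 y, potts_cubic theta q y = 0 & abs y = 1.
Proof.
pose B := - (1 + theta + theta ^+ 2); pose C := (2 * theta + 1) * c.
have P1 : abs (1 * 3 ^+ 3 + B * 3 ^+ 2 + C * 3 + - c ^+ 2) < 1.
  set P := (X in abs X < 1).
  have -> : P = t * - (9%:R * (3%:R + t)) + c * (3%:R * (2%:R * theta + 1) - c).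
    by rewrite {}/P /B /C; ring.
  by apply: padic_absD_lt; apply: padic_absM_lt1 => //; padic_int.
have [||||y yE yd] := @padic_hensel_cubic p p_pr 1 B C (- c ^+ 2) 3 _ _ _ P1.
- by rewrite padic_abs1.
- by rewrite padic_absN coef2_le1.
- by rewrite abs3.
- set P := (X in abs X = 1).
  have -> : P = 3%:R ^+ 2 + (t * - (6%:R * (3%:R + t)) + c * (2%:R * theta + 1)).
    by rewrite {}/P /B /C; ring.
  rewrite padic_absDl padic_absX abs3 expr1n //.
  by apply: padic_absD_lt; apply: padic_absM_lt1 => //; padic_int.
exists y; first by rewrite -yE /potts_cubic /B /C; ring.
by rewrite -(subrK 3 y) padic_absDr abs3 // (le_lt_trans yd).
Qed.

(* The substitution y = c v turns the cubic into c^2 (-3 v^2 + 3 v - 1) modulo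
   smaller terms, and 1 / (1 - w) is a root of -3 v^2 + 3 v - 1. *)
Lemma potts_cubic_small_root (w : Qp p_pr) : w ^+ 2 + w + 1 = 0 -> abs w <= 1 ->
  exists v, [/\ potts_cubic theta q (c * v) = 0, abs v = 1 &
    abs (v - (1 - w)^-1) < 1].
Proof.
move=> hw w1.
have unitl (x y : Qp p_pr) : abs (x * y) = 1 -> abs x <= 1 -> abs y <= 1 ->
    abs x = 1.
  rewrite padic_absM => xy x1 y1; apply/eqP; rewrite eq_le x1 /= -xy.
  by rewrite ler_piMr ?padic_abs_ge0.
(* [1 - w] and [2 + w] are integers whose product is the unit 3. *)
have w1' : abs (1 - w) = 1.
  apply: (@unitl _ (2 + w)).
  - have -> : (1 - w) * (2 + w) = 3 - (w ^+ 2 + w + 1) by ring.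
    by rewrite hw subr0.
  - by rewrite padic_absB_le ?padic_abs1.
  - by rewrite padic_absD_le ?padic_abs_nat_le1.
have aw1 : abs (1 + w) = 1.
  apply: (@unitl _ (- w)); rewrite ?padic_absN ?padic_absD_le ?padic_abs1 //.
  have -> : (1 + w) * - w = 1 - (w ^+ 2 + w + 1) by ring.
  by rewrite hw subr0 padic_abs1.
set v0 := (1 - w)^-1.
have w0 : 1 - w != 0 by rewrite -padic_abs_eq0 w1' oner_eq0.
have v01 : abs v0 = 1 by rewrite padic_absV w1' invr1.
have hv0 : - 3%:R * v0 ^+ 2 + 3%:R * v0 - 1 = 0.
  have -> : - 3%:R * v0 ^+ 2 + 3%:R * v0 - 1 = - (w ^+ 2 + w + 1) / (1 - w) ^+ 2.
    by rewrite /v0; field.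
  by rewrite hw oppr0 mul0r.
pose A := c; pose B := - (1 + theta + theta ^+ 2); pose C := 2 * theta + 1.
have P1 : abs (A * v0 ^+ 3 + B * v0 ^+ 2 + C * v0 + -1) < 1.
  set P : Qp p_pr := (X in abs X < 1).
  have -> : P = c * v0 ^+ 3 + t * (2%:R * v0 - (3%:R + t) * v0 ^+ 2)
      + (- 3%:R * v0 ^+ 2 + 3%:R * v0 - 1) by rewrite {}/P /A /B /C; ring.
  rewrite hv0 addr0.
  by apply: padic_absD_lt; apply: padic_absM_lt1 => //; padic_int.
have [||||v vE vd] := @padic_hensel_cubic p p_pr A B C (- 1) v0 _ _ _ P1.
- by [].
- by rewrite padic_absN coef2_le1.
- by rewrite v01.
(* The derivative reduces to [3 (1 - 2 v0) = -3 (1 + w) v0], a product of units. *)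
- set P : Qp p_pr := (X in abs X = 1).
  have -> : P = 3%:R * (- (1 + w) * v0)
      + (c * (3%:R * v0 ^+ 2) + t * (2%:R - 2%:R * (3%:R + t) * v0)).
    have -> : - (1 + w) * v0 = 1 - 2%:R * v0 by rewrite /v0; field.
    by rewrite {}/P /A /B /C; ring.
  have h1 : abs (3 * (- (1 + w) * v0)) = 1.
    by rewrite !padic_absM padic_absN abs3 aw1 v01 !mulr1.
  rewrite padic_absDl h1 //.
  by apply: padic_absD_lt; apply: padic_absM_lt1 => //; padic_int.
exists v; split.
- have -> : potts_cubic theta q (c * v)
      = c ^+ 2 * (A * v ^+ 3 + B * v ^+ 2 + C * v + -1).
    by rewrite /potts_cubic /A /B /C; ring.
  by rewrite vE mulr0.
- by rewrite -(subrK v0 v) padic_absDr v01 // (le_lt_trans vd).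
- exact: le_lt_trans P1.
Qed.

Lemma potts_cubic_roots_exist : exists y1 y2 y3, potts_cubic_roots theta q y1 y2 y3.
Proof.
have [w hw w1] := padic_primitive_cube_root p_pr p13.
have [y1 y1E y11] := potts_cubic_unit_root.
(* [-1 - w] is the other primitive cube root of unity and supplies the second small root. *)
have hw' : (- 1 - w) ^+ 2 + (- 1 - w) + 1 = 0 by rewrite -hw; ring.
have w1' : abs (-1 - w) <= 1 by rewrite padic_absB_le // padic_absN padic_abs1.
have [v [vE v1 vw]] := potts_cubic_small_root hw w1.
have [v' [v'E v'1 v'w]] := potts_cubic_small_root hw' w1'.
have cE : abs (1 - theta - q) = abs c by rewrite -padic_absN; congr abs; ring.
have ayv : abs (c * v) = abs c by rewrite padic_absM v1 mulr1.
have ayv' : abs (c * v') = abs c by rewrite padic_absM v'1 mulr1.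
have c0 : c != 0 by rewrite -padic_abs_gt0.
(* 1 / (1 - w) and 1 / (2 + w) differ by the unit (2 w + 1) / 3. *)
have vv' : v != v'.
  apply/eqP => vv'; rewrite -vv' in v'w.
  have := padic_absB_lt v'w vw.
  rewrite (_ : v - _ - _ = (1 - w)^-1 - (1 - (- 1 - w))^-1); last by ring.
  have hm : (1 - w) * (1 - (- 1 - w)) = 3 by rewrite -[RHS]subr0 -hw; ring.
  have m0 : (1 - w) * (1 - (- 1 - w)) != 0 by rewrite hm -padic_abs_eq0 abs3.
  have [n1 n2] : 1 - w != 0 /\ 1 - (- 1 - w) != 0.
    by apply/andP; rewrite -negb_or -mulf_eq0.
  have -> : (1 - w)^-1 - (1 - (- 1 - w))^-1 =
      (2%:R * w + 1) / ((1 - w) * (1 - (- 1 - w))).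
    by field; rewrite n1 n2.
  rewrite hm padic_absM padic_absV abs3 invr1 mulr1.
  suff : abs (2 * w + 1) ^+ 2 = 1.
    by move/eqP; rewrite sqrp_eq1 ?padic_abs_ge0 // => /eqP ->; rewrite ltxx.
  rewrite -padic_absX.
  have -> : (2%:R * w + 1) ^+ 2 = 4%:R * (w ^+ 2 + w + 1) - 3%:R by ring.
  by rewrite hw mulr0 sub0r padic_absN.
exists y1, (c * v), (c * v'); split.
- have ny v2 : abs (c * v2) = abs c -> y1 != c * v2.
    move=> e; apply/eqP => y1v; move: y11; rewrite y1v e => c1.
    by move: c_lt1; rewrite -c1 ltxx.
  by rewrite /= !inE !negb_or !ny //= (inj_eq (mulfI c0)) vv'.
- move=> y; rewrite !inE => /or3P[] /eqP->; split=> //.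
  + by rewrite y11.
  + by rewrite ayv.
  + by rewrite ayv'.
- by [].
- by rewrite cE ayv ayv'.
- by rewrite cE.
Qed.

End PottsCubic.

(** * Dynamics of the Potts-Bethe mapping *)

(* Modulo the maximal ideal, u2 and u3 are the two primitive cube roots of 1. *)
Lemma padic_abs_cubeB1 (p : nat) (p_pr : prime p) (u u2 u3 : Qp p_pr) :
  padic_abs u <= 1 -> padic_abs u2 <= 1 ->
  padic_abs (u2 ^+ 3 - 1) < 1 -> padic_abs (u3 ^+ 3 - 1) < 1 ->
  padic_abs (u2 - 1) = 1 -> padic_abs (u3 - 1) = 1 -> padic_abs (u2 - u3) = 1 ->
  padic_abs (u - 1) = 1 -> padic_abs (u - u2) = 1 -> padic_abs (u - u3) = 1 ->
  padic_abs (u ^+ 3 - 1) = 1.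
Proof.
move=> u_le1 u2_le1 u2c u3c u21 u31 u23 u1 uu2 uu3.
have small (v : Qp p_pr) : padic_abs (v ^+ 3 - 1) < 1 -> padic_abs (v - 1) = 1 ->
    padic_abs (v ^+ 2 + v + 1) < 1.
  have -> : v ^+ 3 - 1 = (v - 1) * (v ^+ 2 + v + 1) by ring.
  by rewrite padic_absM => + v1; rewrite v1 mul1r.
set e2 := u2 ^+ 2 + u2 + 1; set s := u2 + u3 + 1.
have e2s : padic_abs e2 < 1 by exact: small.
(* Vieta: subtracting the quadratic relations for [u2] and [u3] leaves [(u2 - u3) * s], and
   [u2 - u3] is a unit. *)
have ss : padic_abs s < 1.
  have -> : padic_abs s = padic_abs ((u2 - u3) * s) by rewrite padic_absM u23 mul1r.
  have -> : (u2 - u3) * s = e2 - (u3 ^+ 2 + u3 + 1) by rewrite /e2 /s; ring.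
  by apply: padic_absB_lt => //; exact: small.
(* This is [u2 * u3 - 1], written so that its smallness is visible. *)
set d := s * u2 - e2.
have ds : padic_abs d < 1 by apply: padic_absB_lt => //; exact: padic_absM_lt1.
have -> : u ^+ 3 - 1 =
    (u - 1) * (u - u2) * (u - u3) + (s * u ^+ 2 - (s + d) * u + d).
  by rewrite /d /s /e2; ring.
have h1 : padic_abs ((u - 1) * (u - u2) * (u - u3)) = 1.
  by rewrite !padic_absM u1 uu2 uu3 !mulr1.
rewrite padic_absDl h1 //; apply: padic_absD_lt => //.
apply: padic_absB_lt; apply: padic_absM_lt1 => //; first by padic_int.
exact: padic_absD_lt.
Qed.

Section PottsDynamics.
Variables (p : nat) (p_pr : prime p) (theta q : Qp p_pr).
Local Notation Qp := (Qp p_pr).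
Local Notation abs := (@padic_abs p p_pr).
Local Notation t := (theta - 1).
Local Notation c := (theta - 1 + q).
Local Notation pole := (potts_pole theta q).
Local Notation f := (potts_bethe theta q).
Implicit Types x y : Qp.

(* In the coordinate x - pole, f is the cube of this Moebius map. *)
Definition potts_moebius x : Qp := theta - t * c / (x - pole).
Local Notation u := potts_moebius.

Definition potts_absorbed : set Qp := \bigcup_n partial_preimage f n (potts_A0 q).

Lemma subr_pole_neq0 x : x != pole -> x - pole != 0.
Proof. by rewrite subr_eq0. Qed.

Lemma potts_bethe_exprE x : x != pole ->
  potts_bethe_expr theta q x = u x ^+ 3.
Proof.
move=> /subr_pole_neq0; rewrite /potts_pole => x0.
rewrite /potts_bethe_expr /u /potts_pole; congr (_ ^+ 3); field.
exact: x0.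
Qed.

Lemma potts_betheE x : x != pole -> f x = Some (u x ^+ 3).
Proof. by move=> x0; rewrite /potts_bethe (negPf x0) potts_bethe_exprE. Qed.

Lemma potts_bethe_defined x y : f x = Some y -> x != pole /\ y = u x ^+ 3.
Proof.
rewrite /potts_bethe; case: eqVneq => // x0 [<-].
by split=> //; exact: potts_bethe_exprE.
Qed.

Lemma potts_moebiusB x y : x != pole -> y != pole ->
  u x - u y = t * c * (x - y) / ((x - pole) * (y - pole)).
Proof.
move=> /subr_pole_neq0 x0 /subr_pole_neq0 y0; rewrite /u.
by move: pole x0 y0 => P x0 y0; field; rewrite x0 y0.
Qed.

Lemma potts_bethe_is_deriv x : x != pole ->
  Qp_is_deriv (potts_bethe_expr theta q) x
    (3 * (t * c) * u x ^+ 2 / (x - pole) ^+ 2).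
Proof.
move=> x0; have xp0 := subr_pole_neq0 x0.
(* The difference quotient with [y - x] cancelled by [potts_moebiusB]; it is continuous at [x], and
   agrees with the quotient when [y] is neither [x] nor the pole. *)
pose G y := t * c * (u y * u y + u y * u x + u x * u x) *
  (y - pole)^-1 * (x - pole)^-1.
have cst (a : Qp) : (fun=> a) @ x^' --> a by exact: cvg_cst.
have idx : (fun y => y) @ x^' --> x.
  apply/padic_cvgP => e e0; apply: nbhs_dnbhs.
  by apply/(@nbhs_ballP rat); exists e.
have invx : (fun y => (y - pole)^-1) @ x^' --> (x - pole)^-1.
  by apply: padic_cvgV => //; apply: padic_cvgD.
have ux : u @ x^' --> u x.
  rewrite (_ : u = fun y => theta + - (t * c) * (y - pole)^-1) /=.
    by apply: padic_cvgD => //; apply: padic_cvgM.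
  by apply/funext => y; rewrite /u mulNr.
have GG : G @ x^' --> G x.
  by apply: padic_cvgM => //; apply: padic_cvgM => //; apply: padic_cvgM => //;
    apply: padic_cvgD; [apply: padic_cvgD|]; apply: padic_cvgM.
have -> : 3 * (t * c) * u x ^+ 2 / (x - pole) ^+ 2 = G x.
  by rewrite /G; move: (u x) (pole) xp0 => U P xp0; field.
have xp_gt0 : 0 < abs (x - pole) by rewrite padic_abs_gt0.
have neq_x : \forall y \near x^', y != x by exact: nbhs_dnbhs_neq.
have neq_pole : \forall y \near x^', y != pole.
  apply: nbhs_dnbhs; apply/(@nbhs_ballP rat); exists (abs (x - pole)) => //= y.
  by rewrite Qp_ballE /=; apply: contraTneq => ->; rewrite ltxx.
apply/padic_cvgP => e e0; move/padic_cvgP: GG => /(_ e e0).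
apply: filterS3 neq_x neq_pole => y yx yp.
suff -> : (potts_bethe_expr theta q y - potts_bethe_expr theta q x) / (y - x) = G y.
  by [].
rewrite !potts_bethe_exprE //.
have -> : u y ^+ 3 - u x ^+ 3 =
    (u y - u x) * (u y * u y + u y * u x + u x * u x) by ring.
have yxn0 : y - x != 0 by rewrite subr_eq0.
rewrite potts_moebiusB // /G; have := subr_pole_neq0 yp.
move: (u y) (u x) (pole) xp0 => U V P xp0 yp0; field.
by rewrite xp0 yp0 yxn0.
Qed.

(** * The attracting fixed point 1 and its basin *)

Hypothesis t_gt0 : 0 < abs t.
Hypothesis t_lt_q : abs t < abs q.
Hypothesis q_lt1 : abs q < 1.
Hypothesis abs3 : abs 3 = 1.

Let q_gt0 : 0 < abs q := lt_trans t_gt0 t_lt_q.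
Let t_lt1 : abs t < 1 := lt_trans t_lt_q q_lt1.
Let tq_gt0 : 0 < abs t * abs q := mulr_gt0 t_gt0 q_gt0.

Let theta1 : abs theta = 1.
Proof. by rewrite -(subrK 1 theta) padic_absDr padic_abs1. Qed.

Let abs_c : abs c = abs q.
Proof. exact: padic_absDr. Qed.

Let subr_pole x : x - pole = (x - 1) + c.
Proof. by rewrite /potts_pole; ring. Qed.

Let one_neq_pole : 1 != pole.
Proof.
by rewrite -subr_eq0 subr_pole subrr add0r -padic_abs_eq0 abs_c gt_eqF.
Qed.

Let u1 : u 1 = 1.
Proof.
have := subr_pole_neq0 one_neq_pole; rewrite /u subr_pole subrr add0r => c0.
by field.
Qed.

Lemma abs_potts_moebiusB x y : x != pole -> y != pole ->
  abs (u x - u y) =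
    abs t * abs q * abs (x - y) / (abs (x - pole) * abs (y - pole)).
Proof.
by move=> x0 y0; rewrite potts_moebiusB // !padic_absM padic_absV padic_absM abs_c.
Qed.

Lemma potts_one_fixed : f 1 = Some 1.
Proof. by rewrite potts_betheE // u1 expr1n. Qed.

Lemma potts_one_attracting : potts_attracting theta q 1.
Proof.
split; first exact: potts_one_fixed.
exists (3 * (t * c) * u 1 ^+ 2 / (1 - pole) ^+ 2); first exact: potts_bethe_is_deriv.
(* Since [1 - pole = c] and [u 1 = 1], the multiplier is [3 t / c], of absolute value
   [|t| / |q|]. *)
rewrite u1 expr1n mulr1 subr_pole subrr add0r !padic_absM padic_absV padic_absX.
rewrite abs3 abs_c mul1r ltr_pdivrMr ?exprn_gt0 // mul1r expr2.
by rewrite ltr_pM2r.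
Qed.

(** On this disc [|x - pole| = |q|], so [u] scales the distance to 1 by [|t| |q| / |q|^2], and
    cubing is an isometry near 1. *)
Lemma potts_A0_step x : abs (x - 1) < abs q ->
  exists2 y, f x = Some y & abs (y - 1) = abs t / abs q * abs (x - 1).
Proof.
move=> xq; have xp : abs (x - pole) = abs q.
  by rewrite subr_pole padic_absDr abs_c.
have x0 : x != pole by rewrite -subr_eq0 -padic_abs_eq0 xp gt_eqF.
exists (u x ^+ 3); first exact: potts_betheE.
have ux : abs (u x - 1) = abs t / abs q * abs (x - 1).
  rewrite -[X in u x - X]u1 abs_potts_moebiusB // xp subr_pole subrr add0r abs_c.
  by field; rewrite gt_eqF.
rewrite -[X in _ - X](expr1n _ 3) padic_abs_cubeB ?padic_abs1 //.
rewrite ux (lt_trans _ q_lt1) // (le_lt_trans _ xq) //.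
by rewrite ler_piMl ?padic_abs_ge0 // ler_pdivrMr // mul1r ltW.
Qed.

Lemma potts_A0_basin : potts_A0 q `<=` basin f 1.
Proof.
move=> x xA; have l01 : 0 <= abs t / abs q < 1.
  by rewrite divr_ge0 ?padic_abs_ge0 //= ltr_pdivrMr // mul1r.
have [l0 l1] := andP l01.
have /choice[v vP] : forall n, exists y, [/\ partial_iter f n x = Some y,
    abs (y - 1) <= abs q * (abs t / abs q) ^+ n & abs (y - 1) < abs q].
  elim=> [|n [y [xy yn yq]]].
    by exists x; split=> //; rewrite expr0 mulr1; exact: ltW.
  have [z yz zE] := potts_A0_step yq; exists z; split.
  - by rewrite partial_iterS xy.
  - by rewrite zE exprS mulrCA ler_wpM2l.
  - by rewrite zE (le_lt_trans _ yq) // ler_piMl ?padic_abs_ge0 // ltW.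
exists v => [n|]; first by have [] := vP n.
apply/padic_cvgP => e e0; have [N hN] := geometric_small (abs q) l01 e0.
exists N => // n /= Nn; rewrite padic_abs_distC.
have [_ vn _] := vP n; apply: le_lt_trans hN; apply: le_trans vn _.
by rewrite ler_wpM2l ?padic_abs_ge0 // ler_wiXn2l // ltW.
Qed.

Lemma potts_basinE : basin f 1 = potts_absorbed.
Proof.
apply/seteqP; split=> [x [v vE /padic_cvgP/(_ _ q_gt0)[n _ /(_ n (leqnn n)) vn]]|].
  exists n => //; exists (v n); first exact: vE.
  by rewrite /potts_A0 /= padic_abs_distC.
by move=> x [n _ [y xy /potts_A0_basin]]; exact (basin_preimage xy).
Qed.

Lemma potts_absorbed_step x y : f x = Some y -> potts_absorbed y ->
  potts_absorbed x.
Proof.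
move=> xy; rewrite -potts_basinE.
have xy1 : partial_iter f 1 x = Some y by [].
exact (basin_preimage xy1).
Qed.

Lemma potts_absorbed_A0 x : abs (x - 1) < abs q -> potts_absorbed x.
Proof. by move=> xq; exists 0%N => //; exists x. Qed.

(** Here [t c / (x - pole)] lies in the maximal ideal, so [u x] is in the residue disc of 1, where
    cubing preserves the distance to 1. *)
Lemma potts_bethe_far x : abs t * abs q < abs (x - pole) ->
  exists2 y, f x = Some y & abs (y - 1) = abs (t - t * c / (x - pole)).
Proof.
move=> xfar; have xp_gt0 := lt_trans tq_gt0 xfar.
have x0 : x != pole by rewrite -subr_eq0 -padic_abs_gt0.
have w1 : abs (t * c / (x - pole)) < 1.
  by rewrite !padic_absM padic_absV abs_c ltr_pdivrMr // mul1r.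
have uE : u x - 1 = t - t * c / (x - pole) by rewrite /u; ring.
exists (u x ^+ 3); first exact: potts_betheE.
rewrite -[X in _ - X](expr1n _ 3) padic_abs_cubeB ?padic_abs1 ?uE //.
exact: padic_absB_lt.
Qed.

Lemma potts_absorbed_far x : abs t < abs (x - pole) -> potts_absorbed x.
Proof.
move=> xfar; have xp_gt0 := lt_trans t_gt0 xfar.
have [|y xy yE] := @potts_bethe_far x.
  by rewrite (le_lt_trans _ xfar) // ler_piMr ?padic_abs_ge0 // ltW.
apply: potts_absorbed_step xy _; apply: potts_absorbed_A0.
rewrite yE padic_absB_lt // !padic_absM padic_absV abs_c.
by rewrite ltr_pdivrMr // mulrC ltr_pM2l.
Qed.

Lemma potts_absorbed_far1 x y : f x = Some y -> abs t < abs (y - pole) ->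
  potts_absorbed x.
Proof. by move=> xy /potts_absorbed_far; exact: potts_absorbed_step. Qed.

(** * Expansion and surjectivity of one branch around a fixed point [xi] *)

Section Branch.
Variables (xi : Qp) (rho : rat).
Hypothesis xi_fixed : f xi = Some xi.
Hypothesis xi_pole : abs (xi - pole) = rho.
Hypothesis rho_ge : abs t * abs q <= rho.
Hypothesis rho_le : rho <= abs t.
Hypothesis rho_q : rho * abs q <= abs t * abs q.

Let rho_gt0 : 0 < rho := lt_le_trans tq_gt0 rho_ge.
Let K : rat := abs t * abs q / rho ^+ 2.

Let K_gt0 : 0 < K.
Proof. by rewrite divr_gt0 // exprn_gt0. Qed.

Let xi_neq : xi != pole := (potts_bethe_defined xi_fixed).1.

Lemma branch_abs x : abs (x - xi) < rho -> abs (x - pole) = rho.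
Proof. by move=> xxi; rewrite -(subrKA xi) padic_absDr xi_pole. Qed.

Lemma branch_moebiusB x y : abs (x - pole) = rho -> abs (y - pole) = rho ->
  abs (u x - u y) = K * abs (x - y).
Proof.
move=> xr yr.
have neq z : abs (z - pole) = rho -> z != pole.
  by move=> zr; rewrite -subr_eq0 -padic_abs_gt0 zr.
rewrite abs_potts_moebiusB ?neq // xr yr.
by rewrite /K; field; rewrite gt_eqF.
Qed.

(** [xi] is a unit near 1 and equals the cube of [u xi]. *)
Lemma fixed_abs1 : abs (u xi) = 1 /\ abs (xi - 1) <= abs q.
Proof.
have x1 : abs (xi - 1) <= abs q.
  have -> : xi - 1 = (xi - pole) - c by rewrite subr_pole; ring.
  by rewrite padic_absB_le ?abs_c // xi_pole (le_trans rho_le) // ltW.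
split=> //; have [_ xiE] := potts_bethe_defined xi_fixed.
have : abs (u xi) ^+ 3 == 1.
  rewrite -padic_absX -xiE -(subrK 1 xi) padic_absDr padic_abs1 //.
  exact: le_lt_trans q_lt1.
by rewrite pexpr_eq1 ?padic_abs_ge0 // => /eqP.
Qed.

Lemma branch_abs1 x : abs (x - xi) < rho ->
  abs (u x - u xi) < 1 /\ abs (u x) = 1.
Proof.
move=> xxi; have uxxi : abs (u x - u xi) < 1.
  rewrite (branch_moebiusB (branch_abs xxi) xi_pole).
  (* [K * rho = |t| |q| / rho] is at most 1 by [rho_ge], so [u] maps the disc into one residue disc
     of units. *)
  apply: lt_le_trans (_ : K * rho <= 1); first by rewrite ltr_pM2l.
  rewrite /K expr2 invfM mulrA mulfVK ?gt_eqF //.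
  by rewrite ler_pdivrMr // mul1r.
have [uxi _] := fixed_abs1.
by split=> //; rewrite -(subrK (u xi) (u x)) padic_absDr uxi.
Qed.

Lemma branch_dist x x' y y' : abs (x - xi) < rho -> abs (x' - xi) < rho ->
  f x = Some y -> f x' = Some y' -> abs (y - y') = K * abs (x - x').
Proof.
move=> xxi x'xi /potts_bethe_defined[_ ->] /potts_bethe_defined[_ ->].
have [ux1 ux] := branch_abs1 xxi; have [ux'1 ux'] := branch_abs1 x'xi.
rewrite padic_abs_cubeB //; first by rewrite branch_moebiusB ?branch_abs.
by rewrite -(subrKA (u xi)) padic_absD_lt // padic_abs_distC.
Qed.

Lemma branch_expand x x' y y' : abs (x - xi) < rho -> abs (x' - xi) < rho ->
  f x = Some y -> f x' = Some y' ->
  abs (x - x') <= abs t / abs q * abs (y - y').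
Proof.
move=> xxi x'xi xy x'y'; rewrite (branch_dist xxi x'xi xy x'y') mulrA.
rewrite ler_peMl ?padic_abs_ge0 //.
(* The rate [|t| / |q|] serves all branches: it loses only the factor [(|t| / rho)^2 >= 1] against
   [K^-1]. *)
have -> : abs t / abs q * K = (abs t / rho) * (abs t / rho).
  by rewrite /K; field; rewrite !gt_eqF.
by rewrite mulr_ege1 // ler_pdivlMr // mul1r.
Qed.

(** The preimage is found in two stages: the cube root [v] of [y] near [u xi], then the inverse of
    the Moebius map at [v]. *)
Lemma branch_onto y : abs (y - pole) < abs q ->
  exists2 x, abs (x - xi) < rho & f x = Some y.
Proof.
move=> yq; have [uxi xi1] := fixed_abs1.
have yxi : abs (y - xi) < abs q.
  rewrite -(subrKA pole) padic_absD_lt // padic_abs_distC xi_pole.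
  exact: le_lt_trans t_lt_q.
have [v vE vu] := padic_cube_root abs3 uxi (lt_trans yxi q_lt1).
have [_ xiE] := potts_bethe_defined xi_fixed.
have vy : v ^+ 3 = y by rewrite vE -xiE; ring.
have xip0 := subr_pole_neq0 xi_neq.
have tc0 : t * c != 0.
  by rewrite -padic_abs_gt0 padic_absM abs_c.
have theta_u : abs (theta - u xi) = abs t * abs q / rho.
  have -> : theta - u xi = t * c / (xi - pole) by rewrite /u; ring.
  by rewrite !padic_absM padic_absV xi_pole abs_c.
(* [|v - u xi| <= |y - xi| < |q|], and [|q| <= |t| |q| / rho] by [rho_q], so replacing [u xi] by [v]
   keeps the absolute value. *)
have theta_v : abs (theta - v) = abs t * abs q / rho.
  have -> : theta - v = (theta - u xi) - (v - u xi) by ring.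
  rewrite padic_absBl theta_u // (le_lt_trans vu) // (lt_le_trans yxi) //.
  by rewrite ler_pdivlMr // mulrC.
have tv0 : theta - v != 0.
  by rewrite -padic_abs_gt0 theta_v divr_gt0.
pose x := pole + t * c / (theta - v).
have xp : x - pole = t * c / (theta - v) by rewrite /x; ring.
have xp0 : x - pole != 0 by rewrite xp mulf_neq0 ?invr_eq0.
have x0 : x != pole by rewrite -subr_eq0.
have ux : u x = v.
  rewrite /u xp; move: (t * c) tc0 => a a0; field.
  by rewrite a0 tv0.
have xr : abs (x - pole) = rho.
  rewrite xp padic_absM padic_absV theta_v padic_absM abs_c.
  by field; rewrite !gt_eqF.
exists x; last by rewrite potts_betheE // ux vy.
(* [|x - xi| < rho] is checked after scaling by [K], where it becomes
   [|v - u xi| < |t| |q| / rho]. *)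
rewrite -(ltr_pM2l K_gt0) -branch_moebiusB // ux.
apply: le_lt_trans vu _; apply: lt_le_trans yxi _.
have -> : K * rho = abs t * abs q / rho by rewrite /K; field; rewrite gt_eqF.
by rewrite ler_pdivlMr // mulrC.
Qed.

Hypothesis rho_lt : rho ^+ 2 < abs t * abs q.

Lemma branch_repelling : potts_repelling theta q xi.
Proof.
split=> //; exists (3 * (t * c) * u xi ^+ 2 / (xi - pole) ^+ 2).
  exact: potts_bethe_is_deriv.
have [uxi _] := fixed_abs1.
rewrite !padic_absM padic_absV !padic_absX abs3 abs_c uxi xi_pole.
by rewrite !mul1r mulr1 ltr_pdivlMr ?exprn_gt0 // mul1r.
Qed.

(** Two fixed points in the disc would have their distance multiplied by [K > 1]. *)
Lemma branch_fixed_unique x : abs (x - xi) < rho -> f x = Some x -> x = xi.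
Proof.
move=> xxi xx; apply/eqP; rewrite -subr_eq0 -padic_abs_eq0; apply/eqP.
have xixi : abs (xi - xi) < rho by rewrite subrr padic_abs0.
have := branch_dist xxi xixi xx xi_fixed.
have K1 : 1 < K by rewrite ltr_pdivlMr ?exprn_gt0 // mul1r.
have := padic_abs_ge0 (x - xi).
nra.
Qed.

End Branch.

(** The proof compares [|x - pole|] with the two critical radii [|t|] and [a = |t| |q|]; except in
    the outermost region, one step leads to [|f x - pole| > |t|]. *)
Lemma potts_escape x1 x2 x3 x :
  f x1 = Some x1 -> f x2 = Some x2 -> f x3 = Some x3 -> x2 != x3 ->
  abs (x1 - pole) = abs t -> abs (x2 - pole) = abs t * abs q ->
  abs (x3 - pole) = abs t * abs q ->
  x != pole -> ~ abs (x - x1) < abs t -> ~ abs (x - x2) < abs t * abs q ->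
  ~ abs (x - x3) < abs t * abs q -> potts_absorbed x.
Proof.
move=> fx1 fx2 fx3 x23 x1p x2p x3p x0 /negP + /negP + /negP.
rewrite -!leNgt => xx1 xx2 xx3.
set a := abs t * abs q in x2p x3p xx2 xx3 *.
have aq : a * abs q <= a by rewrite ler_piMr ?ltW.
have at_ : a < abs t by rewrite /a gtr_pMr.
have a1 : a < 1 := lt_trans at_ t_lt1.
have a2 : a ^+ 2 < a by rewrite expr2 gtr_pMr.
have xp_gt0 : 0 < abs (x - pole) by rewrite padic_abs_gt0 subr_pole_neq0.
have fx := potts_betheE x0.
have [ta|ta|ta] := ltgtP (abs t) (abs (x - pole)).
- exact: potts_absorbed_far.
- have absw : abs (t * c / (x - pole)) = a / abs (x - pole).
    by rewrite !padic_absM padic_absV abs_c.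
  have [xa|xa|xa] := ltgtP a (abs (x - pole)).
  (* Between the radii [|t c / (x - pole)|] exceeds [|q|], hence also [|t|], and it becomes
     [|f x - pole|]. *)
  + have [y xy yE] := potts_bethe_far xa.
    apply: potts_absorbed_far1 xy _.
    have qw : abs q < a / abs (x - pole).
      by rewrite ltr_pdivlMr // /a mulrC ltr_pM2r.
    have yw : abs (y - 1) = a / abs (x - pole).
      by rewrite yE padic_absBr absw // (lt_trans t_lt_q).
    rewrite subr_pole [ltRHS]padic_absDl yw ?abs_c //.
    exact: lt_trans qw.
  (* Inside the smaller radius [u x], and so its cube, has absolute value above 1. *)
  + apply: potts_absorbed_far1 fx _.
    have w1 : 1 < a / abs (x - pole) by rewrite ltr_pdivlMr // mul1r.
    have ux : abs (u x) = a / abs (x - pole).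
      by rewrite /u padic_absBr absw // theta1.
    have ux3 : 1 < abs (u x ^+ 3) by rewrite padic_absX ux exprn_egt1.
    rewrite subr_pole -addrA [ltRHS]padic_absDl; first exact: lt_trans ux3.
    rewrite (le_lt_trans _ ux3) // padic_absD_le ?padic_absN ?padic_abs1 //.
    by rewrite abs_c ltW.
  (* On the smaller sphere [1], [u x2], [u x3] and [u x] are pairwise at distance 1, so [u x]
     reduces to no cube root of unity and [|f x - pole| = 1]. *)
  + apply: potts_absorbed_far1 fx _.
    have abs_eq z : abs (z - pole) = a -> a <= abs (x - z) -> abs (x - z) = a.
      move=> zp xz; apply/eqP; rewrite eq_le xz andbT.
      have -> : x - z = (x - pole) - (z - pole) by ring.
      by rewrite padic_absB_le ?zp -?xa.
    have {}xx2 := abs_eq _ x2p xx2; have {}xx3 := abs_eq _ x3p xx3.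
    have a0 : a != 0 by rewrite gt_eqF.
    have [ra1 ra2] : a <= a /\ a <= abs t.
      by split=> //; exact: ltW.
    (* Were they closer, one disc would contain two fixed points. *)
    have x23a : abs (x2 - x3) = a.
      apply/eqP; rewrite eq_le; apply/andP; split.
        have -> : x2 - x3 = (x2 - pole) - (x3 - pole) by ring.
        by rewrite padic_absB_le ?x2p ?x3p.
      rewrite leNgt; apply/negP => x23a.
      have := branch_fixed_unique fx3 x3p ra1 ra2 a2 x23a fx2.
      by move/eqP; rewrite (negPf x23).
    have u1_dist z : abs (z - pole) = a -> abs (u z - 1) = 1.
      move=> zp; have -> : u z - 1 = t - t * c / (z - pole) by rewrite /u; ring.
      have w1 : abs (t * c / (z - pole)) = 1.
        by rewrite !padic_absM padic_absV abs_c zp divff.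
      by rewrite padic_absBr w1.
    have u_dist y z : abs (y - pole) = a -> abs (z - pole) = a ->
        abs (y - z) = a -> abs (u y - u z) = 1.
      have neq v : abs (v - pole) = a -> v != pole.
        by move=> vp; rewrite -subr_eq0 -padic_abs_gt0 vp.
      move=> yp zp yz; rewrite abs_potts_moebiusB ?neq // yp zp yz -/a.
      by rewrite divff // mulf_neq0.
    have [u2 x21] := fixed_abs1 fx2 x2p ra2.
    have [u3 x31] := fixed_abs1 fx3 x3p ra2.
    have [_ x2E] := potts_bethe_defined fx2.
    have [_ x3E] := potts_bethe_defined fx3.
    have u31 : abs (u x ^+ 3 - 1) = 1.
      apply: (@padic_abs_cubeB1 _ _ _ (u x2) (u x3)).
      * by rewrite -(subrK 1 (u x)) padic_absD_le ?padic_abs1 ?u1_dist.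
      * by rewrite u2.
      * by rewrite -x2E (le_lt_trans x21).
      * by rewrite -x3E (le_lt_trans x31).
      * exact: u1_dist.
      * exact: u1_dist.
      * exact: u_dist.
      * exact: u1_dist.
      * exact: u_dist.
      * exact: u_dist.
    by rewrite subr_pole [ltRHS]padic_absDl u31 ?abs_c.
(* On the larger sphere, outside the disc about [x1], the images of [x] and [x1] are at distance
   [|q|], which exceeds [|x1 - pole| = |t|]. *)
- apply: potts_absorbed_far1 fx _.
  have xx1t : abs (x - x1) = abs t.
    apply/eqP; rewrite eq_le xx1 andbT.
    have -> : x - x1 = (x - pole) - (x1 - pole) by ring.
    by rewrite padic_absB_le ?x1p -?ta.
  have [ux1 x11] := fixed_abs1 fx1 x1p (lexx _).
  have [x10 x1E] := potts_bethe_defined fx1.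
  have uxx1 : abs (u x - u x1) = abs q.
    rewrite abs_potts_moebiusB // xx1t x1p -ta.
    by field; rewrite gt_eqF.
  have -> : u x ^+ 3 - pole = (u x ^+ 3 - x1) + (x1 - pole) by ring.
  have uq : abs (u x ^+ 3 - x1) = abs q by rewrite {1}x1E padic_abs_cubeB ?uxx1.
  by rewrite [ltRHS]padic_absDl uq ?x1p.
Qed.

End PottsDynamics.

(** * Fixed points in the coordinate [y = (x - pole) / t] *)

Section PottsFixedPoints.
Variables (p : nat) (p_pr : prime p) (theta q : Qp p_pr).
Local Notation abs := (@padic_abs p p_pr).
Local Notation t := (theta - 1).
Local Notation c := (theta - 1 + q).
Local Notation pole := (potts_pole theta q).
Local Notation f := (potts_bethe theta q).
Hypothesis t0 : t != 0.

Lemma potts_fixpt_pole y : potts_fixpt theta q y - pole = t * y.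
Proof. by rewrite /potts_fixpt /potts_pole; ring. Qed.

Lemma potts_fixpt_inj : injective (potts_fixpt theta q).
Proof.
by move=> y y' /(congr1 (fun x => x - pole)); rewrite !potts_fixpt_pole => /(mulfI t0).
Qed.

(* Clearing denominators, f x - x is minus (t y - c) times the cubic, where
   x = x_infty + t y; the linear factor is the fixed point 1. *)
Lemma potts_fixpt_eq y : y != 0 ->
  f (potts_fixpt theta q y) = Some (potts_fixpt theta q y) <->
  t * y = c \/ potts_cubic theta q y = 0.
Proof.
move=> y0; set x := potts_fixpt theta q y.
have xp : x - pole = t * y by exact: potts_fixpt_pole.
have x0 : x != pole by rewrite -subr_eq0 xp mulf_neq0.
rewrite potts_betheE //.
have E : potts_moebius theta q x ^+ 3 - x =
    - ((t * y - c) * potts_cubic theta q y) / y ^+ 3.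
  rewrite /potts_moebius xp /potts_cubic /x /potts_fixpt.
  by field; rewrite y0 t0.
split=> [[/eqP]|h].
  rewrite -subr_eq0 E mulf_eq0 invr_eq0 expf_eq0 /= (negPf y0) orbF oppr_eq0.
  by rewrite mulf_eq0 subr_eq0 => /orP[] /eqP; [left | right].
congr Some; apply/eqP; rewrite -subr_eq0 E.
by case: h => ->; rewrite ?subrr ?mulr0 ?mul0r oppr0 mul0r.
Qed.

(** A fourth root would exceed the degree; hence any admissible labelling lists all fixed points
    other than 1. *)
Lemma potts_cubic_root_mem y1 y2 y3 y : uniq [:: y1; y2; y3] ->
  {in [:: y1; y2; y3], forall z, potts_cubic theta q z = 0} ->
  potts_cubic theta q y = 0 -> y \in [:: y1; y2; y3].
Proof.
move=> uy ry yP; apply/negPn/negP => yn.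
pose P := Poly [:: - (1 - theta - q) ^+ 2; - ((2 * theta + 1) * (1 - theta - q));
  - (1 + theta + theta ^+ 2); 1].
have PE z : P.[z] = potts_cubic theta q z.
  by rewrite horner_Poly /= /potts_cubic; ring.
have P0 : P != 0.
  apply/eqP => /(congr1 (fun Q : {poly _} => Q`_3)) /eqP.
  by rewrite coef_Poly coef0 /= oner_eq0.
have : (size (y :: [:: y1; y2; y3]) < size P)%N.
  apply: max_poly_roots P0 _ _; last by rewrite cons_uniq yn uy.
  apply/allP => z; rewrite inE rootE PE => /predU1P[->|/ry->] //.
  by rewrite yP.
by rewrite ltnNge (size_Poly _).
Qed.

End PottsFixedPoints.

(** * Assembly: the three discs as branches, the fixed points, the basin, the conjugacy and the
    covering *)

Theorem theorem3p2 (R : realType) (p : nat) (p_pr : prime p)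
    (theta q : Qp p_pr) :
  p = 1 %[mod 3] ->
  padic_exp_disc R theta ->
  0 < padic_abs (theta - 1) ->
  padic_abs (theta - 1) < padic_abs q ->
  padic_abs q < 1 ->
  (exists y1 y2 y3, potts_cubic_roots theta q y1 y2 y3) /\
  forall y1 y2 y3, potts_cubic_roots theta q y1 y2 y3 ->
  let f := potts_bethe theta q in
  let x0 : Qp p_pr := 1 in
  let x1 := potts_fixpt theta q y1 in
  let x2 := potts_fixpt theta q y2 in
  let x3 := potts_fixpt theta q y3 in
  let C := potts_C1 theta q y1 `|` potts_C23 theta q y2
             `|` potts_C23 theta q y3 in
  [/\ partial_fix f = [set x | x \in [:: x0; x1; x2; x3]] /\
      [/\ potts_attracting theta q x0, potts_repelling theta q x1,
          potts_repelling theta q x2 & potts_repelling theta q x3],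
      partial_dom f `\` C `<=` basin f x0 /\
      basin f x0 = \bigcup_n partial_preimage f n (potts_A0 q) &
      exists J : set (Qp p_pr),
        [/\ J `<=` C,
            conjugate_on f J (@left_shift 3) &
            [set: Qp p_pr] = basin f x0 `|` J `|`
              \bigcup_n partial_preimage f n [set potts_pole theta q]]].
Proof.
move=> p13 _ t_gt0 t_lt_q q_lt1.
have abs3 : padic_abs (3 : Qp p_pr) = 1.
  apply: padic_abs_nat_eq1; rewrite dvdn_prime2 //.
  by apply/eqP => pE; rewrite pE in p13.
pose t := theta - 1; pose c := t + q; pose pole := potts_pole theta q.
pose a := padic_abs t * padic_abs q.
have q_gt0 := lt_trans t_gt0 t_lt_q.
have t_lt1 := lt_trans t_lt_q q_lt1.
have abs_c : padic_abs c = padic_abs q by exact: padic_absDr.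
have t0 : t != 0 by rewrite -padic_abs_gt0.
split.
  by apply: potts_cubic_roots_exist => //; rewrite abs_c.
move=> y1 y2 y3 [uy ry y11 [y2c y3c] _] f x0 x1 x2 x3 C.
have cE : padic_abs (1 - theta - q) = padic_abs q.
  by rewrite -abs_c -padic_absN; congr padic_abs; rewrite /c /t; ring.
have {cE y2c y3c} [y2q y3q] : padic_abs y2 = padic_abs q /\ padic_abs y3 = padic_abs q.
  by rewrite y2c y3c cE.
have yn0 y : y \in [:: y1; y2; y3] -> y != 0.
  rewrite -padic_abs_gt0 !inE => /or3P[] /eqP->; first by rewrite y11.
    by rewrite y2q.
  by rewrite y3q.
(* Indexing by ['I_3] makes the discs an alphabet; the default 0 of [nth] is never reached. *)
pose ys := [:: y1; y2; y3]; pose rs := [:: padic_abs t; a; a].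
pose xi (i : 'I_3) := potts_fixpt theta q (nth 0 ys i).
pose rho (i : 'I_3) := nth 0 rs i.
have ys_mem (i : 'I_3) : nth 0 ys i \in ys by rewrite mem_nth.
have xi_fixed i : f (xi i) = Some (xi i).
  apply/(potts_fixpt_eq _ t0); first exact: yn0.
  by right; have [] := ry _ (ys_mem i).
have xi_pole i : padic_abs (xi i - pole) = rho i.
  rewrite potts_fixpt_pole padic_absM /rho /rs /a.
  by case: i => [[|[|[|i]]]] //= _; rewrite ?y11 ?y2q ?y3q ?mulr1.
have a_gt0 : 0 < a by rewrite mulr_gt0.
have a_lt_t : a < padic_abs t by rewrite gtr_pMr.
have rho_bounds i : [/\ a <= rho i, rho i <= padic_abs t,
    rho i * padic_abs q <= a & rho i ^+ 2 < a].
  have t2 : padic_abs t ^+ 2 < a by rewrite expr2 ltr_pM2l.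
  have aq : a * padic_abs q <= a by rewrite ler_piMr ?ltW.
  have a2 : a ^+ 2 < a by rewrite expr2 gtr_pMr // (lt_trans a_lt_t).
  by rewrite /rho; case: i => [[|[|[|i]]]] //= _; split=> //; exact: ltW.
have rho_gt0 i : 0 < rho i by have [ra _ _ _] := rho_bounds i; exact: lt_le_trans ra.
pose D (i : 'I_3) := [set x : Qp p_pr | padic_abs (x - xi i) < rho i].
have D_pole i x : D i x -> padic_abs (x - pole) = rho i.
  by move=> Dx; exact (branch_abs (xi_pole i) Dx).
(* On the disc the distance to the pole is constantly [rho i], so the defining conditions of each
   C_i reduce to a single inequality. *)
have DE i : [set x | padic_abs (x - xi i) < padic_abs (x - pole) /\
    padic_abs (x - pole) = rho i] = D i.
  apply/seteqP; split=> x /=; first by move=> [+ xr]; rewrite xr.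
  by move=> Dx; rewrite (D_pole i).
have CE x : C x <-> exists i, D i x.
  have C1E : potts_C1 theta q y1 = D ord0 by exact: DE ord0.
  have C2E : potts_C23 theta q y2 = D (inord 1).
    by rewrite -DE /potts_C23 /xi /rho /rs /a inordK // mulrC.
  have C3E : potts_C23 theta q y3 = D (inord 2).
    by rewrite -DE /potts_C23 /xi /rho /rs /a inordK // mulrC.
  rewrite /C C1E C2E C3E; split=> [[[]|]|[i Di]]; try by move=> ?; eexists; eassumption.
  have iE : [|| i == ord0, i == inord 1 | i == inord 2].
    by rewrite -!(inj_eq val_inj) /= !inordK //; case: i {Di} => [[|[|[|i]]]].
  by case/or3P: iE Di => /eqP-> Di; [left; left | left; right | right].
have xi_inj : injective xi.
  move=> i j /(potts_fixpt_inj t0)/eqP; rewrite nth_uniq // => /eqP; exact: val_inj.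
(* A common point forces equal radii, so [xi i] lies in [D j], whose only fixed point is [xi j]. *)
have D_inj i j x : D i x -> D j x -> i = j.
  move=> Di Dj; have rij : rho i = rho j by rewrite -(D_pole _ _ Di) (D_pole _ _ Dj).
  have [ra rt rq r2] := rho_bounds j.
  apply/xi_inj/(branch_fixed_unique t_gt0 t_lt_q q_lt1 abs3 (xi_fixed j) (xi_pole j)
    ra rt r2) => //.
  rewrite -(subrKA x) padic_absD_lt // padic_abs_distC -rij; exact: Di.
have D_sub i x : D i x -> padic_abs (x - pole) < padic_abs q.
  by move=> /D_pole->; have [_ rt _ _] := rho_bounds i; exact: le_lt_trans t_lt_q.
have D_open i x : D i x -> exists2 d, 0 < d & forall y, padic_abs (y - x) < d -> D i y.
  move=> Dx; exists (rho i) => // y yx.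
  by rewrite /D /= -(subrKA x) padic_absD_lt.
have f_onto i y : padic_abs (y - pole) < padic_abs q -> exists2 x, D i x & f x = Some y.
  have [ra rt rq r2] := rho_bounds i.
  exact: (branch_onto t_gt0 t_lt_q q_lt1 abs3 (xi_fixed i) (xi_pole i) ra rt rq).
have f_expand i x x' y y' : D i x -> D i x' -> f x = Some y -> f x' = Some y' ->
    padic_abs (x - x') <= padic_abs t / padic_abs q * padic_abs (y - y').
  have [ra rt rq r2] := rho_bounds i.
  exact: (branch_expand t_gt0 t_lt_q q_lt1 abs3 (xi_fixed i) (xi_pole i) ra rt).
have f_lip i x x' y y' : D i x -> D i x' -> f x = Some y -> f x' = Some y' ->
    padic_abs (y - y') <= a / rho i ^+ 2 * padic_abs (x - x').
  have [ra rt rq r2] := rho_bounds i => Dx Dx' xy x'y'.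
  by rewrite (branch_dist t_gt0 t_lt_q q_lt1 abs3 (xi_fixed i)
    (xi_pole i) ra rt Dx Dx' xy x'y').
have repelling i : potts_repelling theta q (xi i).
  have [ra rt rq r2] := rho_bounds i.
  exact: (branch_repelling t_gt0 t_lt_q q_lt1 abs3 (xi_fixed i)
    (xi_pole i) ra rt r2).
have basinE := potts_basinE t_gt0 t_lt_q q_lt1 abs3.
have escape x : x != pole -> ~ C x -> basin f 1 x.
  move=> xp nC; rewrite basinE.
  have nD i : ~ D i x by move=> Di; apply: nC; apply/CE; exists i.
  have i1 : inord 1 = 1 :> 'I_3 by apply/val_inj; rewrite /= inordK.
  have := nD (inord 1); have := nD (inord 2); have := nD ord0.
  have := xi_pole (inord 1); have := xi_pole (inord 2); have := xi_pole ord0.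
  have := xi_fixed (inord 1); have := xi_fixed (inord 2); have := xi_fixed ord0.
  rewrite /D /xi /rho /rs /= !inordK //= => f1 f3 f2 p1 p3 p2 n1 n3 n2.
  apply: (potts_escape t_gt0 t_lt_q q_lt1 abs3 f1 f2 f3) => //.
  rewrite (inj_eq (potts_fixpt_inj t0)).
  by move: uy => /= /and3P[_ +]; rewrite inE.
split.
- split.
    apply/seteqP; split=> x /=.
      move=> fx; have [xp _] := potts_bethe_defined fx.
      pose y := (x - pole) / t.
      have xE : x = potts_fixpt theta q y.
        apply: (@subIr _ pole); rewrite potts_fixpt_pole mulrC divfK //.
      have y0 : y != 0 by rewrite mulf_neq0 ?invr_eq0 // subr_eq0.
      move: fx; rewrite /partial_fix /= xE => /(potts_fixpt_eq _ t0 y0)[yc|yP].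
        (* The linear factor [t * y = c] gives [x = pole + c = 1]. *)
        rewrite inE; apply/orP; left; apply/eqP/(@subIr _ pole).
        by rewrite potts_fixpt_pole yc /x0 /pole /potts_pole; ring.
      have := @potts_cubic_root_mem _ _ theta q y1 y2 y3 y uy _ yP.
      rewrite !inE !(inj_eq (potts_fixpt_inj t0)) => -> //; first by rewrite orbT.
      by move=> z /ry[].
    rewrite inE => /predU1P[->|xmem].
      exact: (potts_one_fixed t_gt0 t_lt_q).
    have {xmem} : x \in [seq potts_fixpt theta q y | y <- ys] by [].
    case/mapP => y /[dup] yys /ry[yP _] ->.
    by apply/(potts_fixpt_eq _ t0); [exact: yn0 | right].
  split.
  + exact: potts_one_attracting.
  + exact: repelling ord0.
  + by have := repelling (inord 1); rewrite /xi inordK.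
  + by have := repelling (inord 2); rewrite /xi inordK.
- split; last exact: basinE.
  move=> x [xdom nC]; apply: escape nC.
  by apply/eqP => xE; apply: xdom; rewrite /f /potts_bethe xE eqxx.
have l01 : 0 <= padic_abs t / padic_abs q < 1.
  by rewrite divr_ge0 ?padic_abs_ge0 //= ltr_pdivrMr // mul1r.
exists (survivors f D); split.
- by move=> x /survivors_sub[i _ Di]; apply/CE; exists i.
- exact (survivors_conjugate (isT : (0 < 3)%N) q_gt0 l01 D_inj D_sub D_open
    f_onto f_expand f_lip).
apply/seteqP; split=> // x _.
(* A non-surviving orbit reaches the pole, or a point outside all discs, which lies in the basin;
   the latter is closed under preimages. *)
have [xJ|[n [y [xy yP]]]] := survivors_or_escape f D x; first by left; right.
have [yE|yp] := eqVneq y pole.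
  by right; exists n => //; exists y.
left; left; apply: (basin_preimage xy); apply: escape => //.
case: yP => [|nD /CE[i /nD]//].
by rewrite /f potts_betheE.
Qed.
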